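(* Let $0\le q<n$, and consider a reduced-order policy $\mathsf{K}=\begin{bmatrix}0&C_{\mathsf K}\\ B_{\mathsf K}&A_{\mathsf K}\end{bmatrix}\in\mathcal{C}_{q,0}$. For an integer $q'\ge1$ and a stable matrix $\Lambda\in\mathbb{R}^{q'\times q'}$, let $$\tilde{\mathsf K}=\begin{bmatrix}0&C_{\mathsf K}&0\\ B_{\mathsf K}&A_{\mathsf K}&0\\ 0&0&\Lambda\end{bmatrix}$$ (so that $A_{\tilde{\mathsf K}}=\begin{bmatrix}A_{\mathsf K}&0\\ 0&\Lambda\end{bmatrix}$, $B_{\tilde{\mathsf K}}=\begin{bmatrix}B_{\mathsf K}\\ 0\end{bmatrix}$, $C_{\tilde{\mathsf K}}=\begin{bmatrix}C_{\mathsf K}&0\end{bmatrix}$). The following statements hold. 1. For any $q'\ge1$ and any stable $\Lambda\in\mathbb{R}^{q'\times q'}$, the policy $\tilde{\mathsf K}$ belongs to $\mathcal{C}_{q+q',0}$ and satisfies $J_{\mathtt{LQG},q+q'}(\tilde{\mathsf K})=J_{\mathtt{LQG},q}(\mathsf K)$. 2. If $\mathsf K$ is a stationary point of $J_{\mathtt{LQG},q}$, i.e., $\nabla J_{\mathtt{LQG},q}(\mathsf K)=0$, then for any $q'\ge1$ and any stable $\Lambda\in\mathbb{R}^{q'\times q'}$, $\tilde{\mathsf K}$ is a stationary point of $J_{\mathtt{LQG},q+q'}$ over $\mathcal{C}_{q+q',0}$. 3. Let $q'=n-q$. If $\mathsf K\in\mathcal{C}_{q,0}$ is minimal, then for any stable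 $\Lambda\in\mathbb{R}^{q'\times q'}$ the policy $\tilde{\mathsf K}$ is degenerate, i.e., $\tilde{\mathsf K}\in\mathcal{C}_{n,0}\setminus\mathcal{C}_{\mathrm{nd},0}$.
   Context: Plant data: integers $n,m,p\ge 1$, real matrices $A\in\mathbb{R}^{n\times n}$, $B\in\mathbb{R}^{n\times m}$, $C\in\mathbb{R}^{p\times n}$, and symmetric weights $Q\succeq 0$, $W\succeq 0$ ($n\times n$), $R\succ 0$ ($m\times m$), $V\succ 0$ ($p\times p$); $M^{1/2}$ is the symmetric positive semidefinite square root. Standing assumptions: $(A,B)$ and $(A,W^{1/2})$ are controllable, $(C,A)$ and $(Q^{1/2},A)$ are observable. A square matrix is stable if all its eigenvalues have strictly negative real parts. A strictly proper dynamic policy of order $q\ge0$ is a matrix $\mathsf{K}=\begin{bmatrix}0 & C_{\mathsf K}\\ B_{\mathsf K} & A_{\mathsf K}\end{bmatrix}$ with $A_{\mathsf K}\in\mathbb{R}^{q\times q}$, $B_{\mathsf K}\in\mathbb{R}^{q\times p}$, $C_{\mathsf K}\in\mathbb{R}^{m\times q}$ and zero $m\times p$ upper-left block; $\mathcal{V}_q$ is the vector space of all such matrices. It is minimal if $(A_{\mathsf K},B_{\mathsf K})$ is controllable and $(C_{\mathsf K},A_{\mathsf K})$ is observable. Define $$A_{\mathrm{cl}}(\mathsf K)=\begin{bmatrix}A & BC_{\mathsf K}\\ B_{\mathsf K}C & A_{\mathsf K}\end{bmatrix},\quad B_{\mathrm{cl}}(\mathsf K)=\begin{bmatrix}W^{1/2}&0\\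 0&B_{\mathsf K}V^{1/2}\end{bmatrix},\quad C_{\mathrm{cl}}(\mathsf K)=\begin{bmatrix}Q^{1/2}&0\\ 0&R^{1/2}C_{\mathsf K}\end{bmatrix}.$$ $\mathcal{C}_{q,0}=\{\mathsf K\in\mathcal{V}_q: A_{\mathrm{cl}}(\mathsf K)\text{ is stable}\}$, an open subset of $\mathcal{V}_q$. The LQG cost is $J_{\mathtt{LQG},q}(\mathsf K)=\|\mathbf{T}(\mathsf K,\cdot)\|_{\mathcal{H}_2}$ for $\mathsf K\in\mathcal{C}_{q,0}$, where $\mathbf{T}(\mathsf K,s)=C_{\mathrm{cl}}(\mathsf K)(sI-A_{\mathrm{cl}}(\mathsf K))^{-1}B_{\mathrm{cl}}(\mathsf K)$ and $\|\mathbf{T}\|_{\mathcal{H}_2}^2=\frac{1}{2\pi}\int_{-\infty}^{\infty}\operatorname{tr}(\mathbf{T}(j\omega)^{\mathsf H}\mathbf{T}(j\omega))\,d\omega$. It is real analytic on $\mathcal{C}_{q,0}$; $\nabla J_{\mathtt{LQG},q}$ is the gradient with respect to $(A_{\mathsf K},B_{\mathsf K},C_{\mathsf K})$, and a stationary point is a point where it vanishes. $\mathcal{C}_{\mathrm{nd},0}$ (the non-degenerate policies for LQG) is the set of $\mathsf K\in\mathcal{C}_{n,0}$ such that, with $\gamma=J_{\mathtt{LQG},n}(\mathsf K)$, there exist a symmetric positive definite $P=\begin{bmatrix}P_{11}&P_{12}\\ P_{12}^{\mathsf T}&P_{22}\end{bmatrix}\in\mathbb{R}^{2n\times 2n}$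 (with $n\times n$ blocks) whose block $P_{12}$ is invertible, and a symmetric $\Gamma$, such that $$\begin{bmatrix}A_{\mathrm{cl}}(\mathsf K)^{\mathsf T}P+PA_{\mathrm{cl}}(\mathsf K)&PB_{\mathrm{cl}}(\mathsf K)\\ B_{\mathrm{cl}}(\mathsf K)^{\mathsf T}P&-\gamma I\end{bmatrix}\preceq0,\quad\begin{bmatrix}P&C_{\mathrm{cl}}(\mathsf K)^{\mathsf T}\\ C_{\mathrm{cl}}(\mathsf K)&\Gamma\end{bmatrix}\succeq0,\quad\operatorname{tr}(\Gamma)\le\gamma.$$ *)

(* Defs.v *)
From mathcomp Require Import all_boot all_order all_algebra.
From mathcomp Require Import complex.
From mathcomp Require Import all_classical all_reals all_analysis.

Set Implicit Arguments.
Unset Strict Implicit.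
Unset Printing Implicit Defensive.

Import Order.TTheory GRing.Theory Num.Theory.
Import numFieldNormedType.Exports.

Local Open Scope classical_set_scope.
Local Open Scope ring_scope.

Section Matrices.
Variable R : realType.

Definition psdmx k (M : 'M[R]_k) : Prop :=
  M^T = M /\ forall x : 'cV[R]_k, 0 <= (x^T *m M *m x) ord0 ord0.

Definition pdmx k (M : 'M[R]_k) : Prop :=
  M^T = M /\ forall x : 'cV[R]_k, x != 0 -> 0 < (x^T *m M *m x) ord0 ord0.

Definition nsdmx k (M : 'M[R]_k) : Prop := psdmx (- M).

(* For M positive semidefinite the set below is a singleton; otherwise it is
   empty and the value is 0. *)
Definition sqrtmx k (M : 'M[R]_k) : 'M[R]_k :=
  xget 0 [set S | psdmx S /\ S *m S = M].

Definition cplxmx k l (M : 'M[R]_(k, l)) : 'M[R[i]]_(k, l) :=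
  map_mx (real_complex R) M.

Definition stable_mx k (M : 'M[R]_k) : Prop :=
  forall z : R[i], eigenvalue (cplxmx M) z -> complex.Re z < 0.

(* Rank of the Kalman matrix [B, A B, ..., A^(k-1) B]. *)
Definition controllable k l (A : 'M[R]_k) (B : 'M[R]_(k, l)) : Prop :=
  \rank (\mxrow_(i < k) (A ^+ i *m B)) = k.

(* Rank of the Kalman matrix [C; C A; ...; C A^(k-1)]. *)
Definition observable k l (C : 'M[R]_(l, k)) (A : 'M[R]_k) : Prop :=
  \rank (\mxcol_(i < k) (C *m A ^+ i)) = k.

(* tr (T^H T) is real, so taking its real part loses nothing. *)
Definition h2norm k l (T : R[i] -> 'M[R[i]]_(k, l)) : R :=
  Num.sqrt ((2 * pi)^-1 *
    \int[lebesgue_measure]_(w in setT)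
      complex.Re (\tr ((map_mx (@conjc R) (T (0 +i* w)%C))^T *m T (0 +i* w)%C))).

End Matrices.

Record plant (R : realType) (n m p : nat) := Plant {
  plA : 'M[R]_n;
  plB : 'M[R]_(n, m);
  plC : 'M[R]_(p, n);
  plQ : 'M[R]_n;
  plW : 'M[R]_n;
  plR : 'M[R]_m;
  plV : 'M[R]_p }.

Record standing_assumptions (R : realType) (n m p : nat) (G : plant R n m p)
    : Prop := StandingAssumptions {
  plQ_psd : psdmx (plQ G);
  plW_psd : psdmx (plW G);
  plR_pd : pdmx (plR G);
  plV_pd : pdmx (plV G);
  plAB_controllable : controllable (plA G) (plB G);
  plAW_controllable : controllable (plA G) (sqrtmx (plW G));
  plCA_observable : observable (plC G) (plA G);
  plQA_observable : observable (sqrtmx (plQ G)) (plA G) }.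

(* The strictly proper policies of order q, identified with the triples
   (A_K, B_K, C_K) of blocks of [0, C_K; B_K, A_K]; as a product of matrix
   spaces this is a normed vector space, also when q = 0. *)
Notation policy R m p q :=
  ('M[R]_q * 'M[R]_(q, p) * 'M[R]_(m, q))%type.

Section Policies.
Variables (R : realType) (n m p : nat) (G : plant R n m p).

Definition poA q (K : policy R m p q) : 'M[R]_q := K.1.1.
Definition poB q (K : policy R m p q) : 'M[R]_(q, p) := K.1.2.
Definition poC q (K : policy R m p q) : 'M[R]_(m, q) := K.2.

Definition minimal_policy q (K : policy R m p q) : Prop :=
  controllable (poA K) (poB K) /\ observable (poC K) (poA K).

Definition Acl q (K : policy R m p q) : 'M[R]_(n + q) :=
  block_mx (plA G) (plB G *m poC K) (poB K *m plC G) (poA K).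

Definition Bcl q (K : policy R m p q) : 'M[R]_(n + q, n + p) :=
  block_mx (sqrtmx (plW G)) 0 0 (poB K *m sqrtmx (plV G)).

Definition Ccl q (K : policy R m p q) : 'M[R]_(n + m, n + q) :=
  block_mx (sqrtmx (plQ G)) 0 0 (sqrtmx (plR G) *m poC K).

Definition stabilizing q : set (policy R m p q) :=
  [set K | stable_mx (Acl K)].

Definition transfer q (K : policy R m p q) (s : R[i])
    : 'M[R[i]]_(n + m, n + p) :=
  cplxmx (Ccl K) *m invmx (s%:M - cplxmx (Acl K)) *m cplxmx (Bcl K).

(* Meaningful on [stabilizing q], where the integral converges. *)
Definition lqg_cost q (K : policy R m p q) : R := h2norm (transfer K).

(* Partial derivatives with respect to the entries of (A_K, B_K, C_K). *)
Definition gradient q (f : policy R m p q -> R) (K : policy R m p q)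
    : policy R m p q :=
  (\matrix_(i, j) 'D_(delta_mx i j, 0, 0) f K,
   \matrix_(i, j) 'D_(0, delta_mx i j, 0) f K,
   \matrix_(i, j) 'D_(0, 0, delta_mx i j) f K).

(* Differentiability is required because 'D_v is a total operator, with a
   default value where the derivative does not exist; [stabilizing q] is open,
   so the values of the cost outside of it are irrelevant. *)
Definition stationary_point q (K : policy R m p q) : Prop :=
  [/\ stabilizing K,
      differentiable (lqg_cost (q := q)) K &
      gradient (lqg_cost (q := q)) K = 0].

Definition nondegenerate_policy : set (policy R m p n) :=
  [set K | stabilizing K /\
    exists (P : 'M[R]_(n + n)) (Gam : 'M[R]_(n + m)),
      let gam := lqg_cost K in
      [/\ pdmx P /\ ursubmx P \in unitmx,
          Gam^T = Gam,
          nsdmx (block_mx ((Acl K)^T *m P + P *m Acl K) (P *m Bcl K)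
                          ((Bcl K)^T *m P) (- gam%:M)),
          psdmx (block_mx P (Ccl K)^T (Ccl K) Gam) &
          \tr Gam <= gam]].

Definition augment_policy q q' (K : policy R m p q) (L : 'M[R]_q')
    : policy R m p (q + q') :=
  (block_mx (poA K) 0 0 L, col_mx (poB K) 0, row_mx (poC K) 0).

Definition cast_policy q r (e : q = r) (K : policy R m p q)
    : policy R m p r :=
  (castmx (e, e) (poA K), castmx (e, erefl p) (poB K),
   castmx (erefl m, e) (poC K)).

End Policies.

(* Main.v *)
Require Import Defs.
From mathcomp Require Import all_boot all_order all_algebra.
From mathcomp Require Import complex ring lra.
From mathcomp Require Import all_classical all_reals all_analysis.
From mathcomp Require Import measurable_realfun.

Set Implicit Arguments.
Unset Strict Implicit.
Unset Printing Implicit Defensive.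

Import Order.TTheory GRing.Theory Num.Theory.
Import numFieldNormedType.Exports.

Local Open Scope classical_set_scope.
Local Open Scope ring_scope.

(** Everything rests on one integral.  For a stable real matrix A let
    G(w) = (jw - A)^-1.  Its principal value over the real line is pi times
    the identity, whatever A is: by the Cayley-Hamilton theorem G is a
    combination of functions 1 / prod_i (jw - l_i) with all l_i in the left
    half plane; partial fractions and explicit antiderivatives show that such
    a function has principal value pi when it has one factor and 0 when it has
    more.  If A E + E A^T = - M, then G M G^H = G E + E G^H, so the principal
    value of G M G^H is 2 pi E ([pv_lyapunov]).  Hence the Lyapunov equation
    has at most one solution, that solution is positive semidefinite when M
    is, and, for M = B B^T, the H2 norm is the square root of tr (C E C^T)
    ([lyapunov_kernel0], [lyapunov_psd], [h2norm_lyapunov]).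

    Cost of the augmented policy.  The closed loop of the augmented policy is
    the original one next to an uncoupled block L that is neither excited nor
    observed, so the eigenvalues are those of the two blocks and the transfer
    functions agree on the imaginary axis ([augment_stabilizing],
    [augment_lqg_cost]).

    Stationarity.  Near a stabilizing policy the squared cost is
    tr (C X C^T), where X solves a linear system with invertible matrix and
    is therefore a rational function of the policy; it is positive because a
    closed loop with zero gain would see no noise at all, contradicting
    controllability from W^(1/2).  So the cost is differentiable
    ([lqg_cost_differentiable]), and it suffices to kill its derivative along
    two complementary spaces of directions.  Along block-diagonal directions
    the augmented cost is the cost of the small policy, which is stationary
    ([derive_augment]).  Along block-off-diagonal directions it is an even
    function, since the change of controller coordinates diag(1, -1) fixes the
    augmented policy and reverses these directions ([derive_offdiag]).

    Degeneracy.  From a certificate P put Y = P^-1 and let X be the Gramian of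
    the augmented closed loop.  The matrix inequalities say that D = gam Y - X
    is positive semidefinite, solves a Lyapunov equation with semidefinite
    right-hand side, and satisfies tr (C D C^T) <= 0.  Then C A^i D = 0 for
    all i, and observability of the plant makes the plant rows of D vanish.
    The plant rows of X vanish on the added controller states; hence so do
    those of Y, which is impossible when P12 is invertible
    ([augment_certificate], [augment_degenerate]). *)

(** * Principal values along the imaginary axis *)

Section ComplexParts.
Variable R : realType.
Implicit Types z w : R[i].

Lemma complex_ReD z w : complex.Re (z + w) = complex.Re z + complex.Re w.
Proof. by case: z w => [? ?] [? ?]. Qed.

Lemma complex_ImD z w : complex.Im (z + w) = complex.Im z + complex.Im w.
Proof. by case: z w => [? ?] [? ?]. Qed.

Lemma complex_ReM z w : complex.Re (z * w) =
  complex.Re z * complex.Re w - complex.Im z * complex.Im w.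
Proof. by case: z w => [? ?] [? ?]. Qed.

Lemma complex_ImM z w : complex.Im (z * w) =
  complex.Re z * complex.Im w + complex.Im z * complex.Re w.
Proof. by case: z w => [? ?] [? ?]. Qed.

Lemma complex_eq z w : complex.Re z = complex.Re w ->
  complex.Im z = complex.Im w -> z = w.
Proof. by case: z w => [? ?] [? ?] /= -> ->. Qed.

End ComplexParts.

Section PrincipalValue.
Variable R : realType.
Implicit Types (f g F : R -> R) (u v : R -> R[i]).

(** Witnessing the principal value by an antiderivative makes the notion stable
    under linear combinations without any integrability condition; the
    symmetric bounds -k and k matter, because 1 / (jw - l) is not integrable. *)
Definition pv_real f (c : R) : Prop :=
  continuous f /\ exists2 F : R -> R, (forall w : R, is_derive w 1 F (f w)) &
    F k%:R - F (- k%:R) @[k --> \oo] --> c.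

Definition pv u (c : R[i]) : Prop :=
  pv_real (fun w => complex.Re (u w)) (complex.Re c) /\
  pv_real (fun w => complex.Im (u w)) (complex.Im c).

Lemma pv_real0 : pv_real (fun=> 0) 0.
Proof.
split; first by move=> x; exact: cvg_cst.
exists (fun=> 0) => [w|]; first exact: is_derive_cst.
by rewrite subrr; exact: cvg_cst.
Qed.

Lemma pv_realD f g a b : pv_real f a -> pv_real g b ->
  pv_real (fun w => f w + g w) (a + b).
Proof.
move=> [fc [F dF Fa]] [gc [H dH Hb]]; split.
  by move=> x; apply: cvgD; [exact: fc|exact: gc].
exists (fun w => F w + H w) => [w|]; first exact: is_deriveD.
rewrite (_ : (fun k => _) = (fun k : nat => F k%:R - F (- k%:R)) \+
  (fun k : nat => H k%:R - H (- k%:R))); first exact: cvgD.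
by apply/funext => k /=; ring.
Qed.

Lemma pv_realZ k f a : pv_real f a -> pv_real (fun w => k * f w) (k * a).
Proof.
move=> [fc [F dF Fa]]; split.
  by move=> x; apply: cvgM; [exact: cvg_cst|exact: fc].
exists (fun w => k * F w) => [w|].
  exact: (is_deriveZ k (dF w)).
rewrite (_ : (fun j => _) = (fun j : nat => k * (F j%:R - F (- j%:R)))).
  by apply: cvgM => //; exact: cvg_cst.
by apply/funext => j /=; ring.
Qed.

Lemma pv_realN f a : pv_real f a -> pv_real (fun w => - f w) (- a).
Proof.
move=> /(pv_realZ (-1)); rewrite mulN1r => h.
by under eq_fun do rewrite -mulN1r.
Qed.

(** An antiderivative of a nonnegative function is nondecreasing, so positivity
    of principal values needs no integral. *)
Lemma pv_real_ge0 f c : pv_real f c -> (forall w, 0 <= f w) -> 0 <= c.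
Proof.
move=> [fc [F dF Fc]] f0; rewrite -(cvg_lim (@Rhausdorff R) Fc).
apply: limr_ge; first by apply/cvg_ex; exists c.
apply: nearW => k; rewrite subr_ge0.
apply: (@ger0_derive1_le_cc _ F (- k%:R) k%:R) => //.
- by move=> x _; rewrite derive1E; have [_ ->] := dF x.
- apply: continuous_subspaceT => x.
  by apply: differentiable_continuous; apply/derivable1_diffP; have [] := dF x.
- by rewrite in_itv /= lexx ge0_cp ?ler0n.
- by rewrite in_itv /= lexx ge0_cp ?ler0n.
- by rewrite ge0_cp ?ler0n.
Qed.

Lemma pv_ext u v c : u =1 v -> pv u c -> pv v c.
Proof. by move=> /funext ->. Qed.

Lemma pv0 : pv (fun=> 0) 0.
Proof. by split; exact: pv_real0. Qed.

Lemma pvD u v a b : pv u a -> pv v b -> pv (fun w => u w + v w) (a + b).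
Proof.
move=> [u1 u2] [v1 v2]; rewrite /pv complex_ReD complex_ImD; split.
  by under eq_fun do rewrite complex_ReD; exact: pv_realD.
by under eq_fun do rewrite complex_ImD; exact: pv_realD.
Qed.

Lemma pvZ z u a : pv u a -> pv (fun w => z * u w) (z * a).
Proof.
move=> [u1 u2]; rewrite /pv complex_ReM complex_ImM; split.
  under eq_fun do rewrite complex_ReM.
  by apply: pv_realD; [|apply: pv_realN]; exact: pv_realZ.
by under eq_fun do rewrite complex_ImM; apply: pv_realD; exact: pv_realZ.
Qed.

Lemma pv_conj u a : pv u a -> pv (fun w => conjc (u w)) (conjc a).
Proof.
move=> [u1 u2]; rewrite /pv; split.
  have -> : complex.Re (conjc a) = complex.Re a by case: (a).
  by under eq_fun => w do
    have -> : complex.Re (conjc (u w)) = complex.Re (u w) by case: (u w).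
have -> : complex.Im (conjc a) = - complex.Im a by case: (a).
under eq_fun => w do
  have -> : complex.Im (conjc (u w)) = - complex.Im (u w) by case: (u w).
exact: pv_realN.
Qed.

End PrincipalValue.

(** * Scalar resolvents and partial fractions *)

Lemma cvg0_inv_bound (R : realType) (g : nat -> R) (M : R) :
  (forall k, (0 < k)%N -> `|g k| <= M / k%:R) -> g k @[k --> \oo] --> (0 : R).
Proof.
move=> gM; suff: [sequence g k.+1]_k @ \oo --> (0 : R) by rewrite cvg_shiftS.
have M0 : M * harmonic k @[k --> \oo] --> (0 : R).
  rewrite -[X in _ --> X](mulr0 M); apply: cvgM; first exact: cvg_cst.
  exact: cvg_harmonic.
apply: (@squeeze_cvgr _ _ _ _ (fun k => - (M * harmonic k))
  (fun k => M * harmonic k)) => //.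
  by apply: nearW => k; rewrite -ler_norml; exact: gM.
by rewrite -oppr0; exact: cvgN.
Qed.

Section ResolventIntegrals.
Variable R : realType.
Implicit Types (u v : R -> R[i]) (s : nat -> R[i]).

Definition cderive u v : Prop := forall w : R,
  is_derive w 1 (fun x => complex.Re (u x)) (complex.Re (v w)) /\
  is_derive w 1 (fun x => complex.Im (u x)) (complex.Im (v w)).

Lemma cderiveM u u' v v' : cderive u u' -> cderive v v' ->
  cderive (fun w => u w * v w) (fun w => u' w * v w + u w * v' w).
Proof.
move=> du dv w; have [du1 du2] := du w; have [dv1 dv2] := dv w; split.
  have -> : (fun x => complex.Re (u x * v x)) =
      (fun x => complex.Re (u x)) * (fun x => complex.Re (v x)) -
      (fun x => complex.Im (u x)) * (fun x => complex.Im (v x)).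
    by apply/funext => x; rewrite complex_ReM.
  apply: is_derive_eq.
  by rewrite complex_ReD !complex_ReM /GRing.scale /=; ring.
have -> : (fun x => complex.Im (u x * v x)) =
    (fun x => complex.Re (u x)) * (fun x => complex.Im (v x)) +
    (fun x => complex.Im (u x)) * (fun x => complex.Re (v x)).
  by apply/funext => x; rewrite complex_ImM.
apply: is_derive_eq.
by rewrite complex_ImD !complex_ImM /GRing.scale /=; ring.
Qed.

Lemma cderive_cst z : cderive (fun=> z) (fun=> 0).
Proof. by move=> w; split; exact: is_derive_cst. Qed.

Lemma cderive_eq u v v' : cderive u v -> v =1 v' -> cderive u v'.
Proof. by move=> du /funext <-. Qed.

Lemma cderive_continuous u v : cderive u v ->
  continuous (fun x => complex.Re (u x)) /\
  continuous (fun x => complex.Im (u x)).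
Proof.
move=> du; split => x; apply: differentiable_continuous;
  apply/derivable1_diffP; have [[h _] [h' _]] := du x.
- exact: h.
- exact: h'.
Qed.

Definition ccvg0 s : Prop :=
  (complex.Re (s k) @[k --> \oo] --> (0 : R)) /\
  (complex.Im (s k) @[k --> \oo] --> (0 : R)).

Lemma ccvg0M s t : ccvg0 s -> ccvg0 t -> ccvg0 (fun k => s k * t k).
Proof.
move=> [s1 s2] [t1 t2]; split.
  under eq_fun do rewrite complex_ReM.
  have -> : (0 : R) = 0 * 0 - 0 * 0 by rewrite mulr0 subrr.
  by apply: cvgB; exact: cvgM.
under eq_fun do rewrite complex_ImM.
have -> : (0 : R) = 0 * 0 + 0 * 0 by rewrite mulr0 addr0.
by apply: cvgD; exact: cvgM.
Qed.

Lemma ccvg0Z z s : ccvg0 s -> ccvg0 (fun k => z * s k).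
Proof.
move=> [s1 s2]; split.
  under eq_fun do rewrite complex_ReM.
  have -> : (0 : R) = complex.Re z * 0 - complex.Im z * 0.
    by rewrite !mulr0 subrr.
  by apply: cvgB; apply: cvgM => //; exact: cvg_cst.
under eq_fun do rewrite complex_ImM.
have -> : (0 : R) = complex.Re z * 0 + complex.Im z * 0.
  by rewrite !mulr0 addr0.
by apply: cvgD; apply: cvgM => //; exact: cvg_cst.
Qed.

(** The second derivative enters only to make the integrand continuous. *)
Lemma pv_antiderivative u v v' : cderive u v -> cderive v v' ->
  ccvg0 (fun k => u k%:R) -> ccvg0 (fun k => u (- k%:R)) -> pv v 0.
Proof.
move=> du dv [p1 p2] [m1 m2]; have [c1 c2] := cderive_continuous dv.
split; split => //.
- exists (fun w => complex.Re (u w)) => [w|]; first by have [] := du w.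
  by rewrite -[X in _ --> X](subrr (0 : R)); exact: cvgB.
- exists (fun w => complex.Im (u w)) => [w|]; first by have [] := du w.
  by rewrite -[X in _ --> X](subrr (0 : R)); exact: cvgB.
Qed.

Variable l : R[i].
Hypothesis l_stable : complex.Re l < 0.
Let a := - complex.Re l.
Let b := complex.Im l.
Let h (w : R) : R[i] := ((0 +i* w)%C - l)^-1.

Let a_gt0 : 0 < a. Proof. by rewrite oppr_gt0. Qed.

Let den_gt0 w : 0 < a ^+ 2 + (w - b) ^+ 2.
Proof. by rewrite ltr_wpDr ?sqr_ge0 // exprn_gt0. Qed.

Let Re_h w : complex.Re (h w) = a / (a ^+ 2 + (w - b) ^+ 2).
Proof. by rewrite /h /a /b; case: l => x y /=; rewrite sub0r. Qed.

Let Im_h w : complex.Im (h w) = - ((w - b) / (a ^+ 2 + (w - b) ^+ 2)).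
Proof. by rewrite /h /a /b; case: l => x y /=; rewrite sub0r. Qed.

Lemma resolvent_neq0 w : (0 +i* w)%C - l != 0.
Proof.
apply/eqP => /(congr1 (@complex.Re R)); rewrite /a; move: l_stable.
by case: l => x y /= x_lt0; lra.
Qed.


Let den_derive (w : R) :
  is_derive w 1 (fun x => a ^+ 2 + (x - b) ^+ 2) (2 * (w - b)).
Proof.
apply: is_derive_eq.
by rewrite /GRing.scale /=; ring.
Qed.

Let sub_derive (w : R) : is_derive w 1 (fun x => x - b) 1.
Proof. by apply: is_derive_eq; rewrite subr0. Qed.

Let invden_derive (w : R) :
  is_derive w 1 (fun x => (a ^+ 2 + (x - b) ^+ 2)^-1)
    (- (a ^+ 2 + (w - b) ^+ 2) ^- 2 * (2 * (w - b))).
Proof.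
exact: (@is_deriveV _ (fun x => a ^+ 2 + (x - b) ^+ 2) _ _ _
  (lt0r_neq0 (den_gt0 w)) (den_derive w)).
Qed.

Lemma cderive_resolvent : cderive h (fun w => - 'i%C * (h w * h w)).
Proof.
have d0 w : a ^+ 2 + (w - b) ^+ 2 != 0 by rewrite gt_eqF.
move=> w; split.
  have -> : (fun x => complex.Re (h x)) =
    (a \*: (fun x => (a ^+ 2 + (x - b) ^+ 2)^-1)).
    by apply/funext => x; rewrite Re_h.
  apply: is_derive_eq.
  rewrite !(complex_ReM, complex_ImM) /= /GRing.scale /= Re_h Im_h.
  by field.
have -> : (fun x => complex.Im (h x)) =
  - ((fun x => x - b) * (fun x => (a ^+ 2 + (x - b) ^+ 2)^-1)).
  by apply/funext => x; rewrite Im_h.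
apply: is_derive_eq.
rewrite !(complex_ReM, complex_ImM) /= /GRing.scale /= Re_h Im_h.
by field.
Qed.


(** Cauchy-Schwarz for t = (t - b) + b: the squared modulus of jt - l grows at
    least quadratically in t. *)
Let den_growth (t : R) : a ^+ 2 * t ^+ 2 <=
  (a ^+ 2 + b ^+ 2) * (a ^+ 2 + (t - b) ^+ 2).
Proof.
rewrite -subr_ge0; have -> : (a ^+ 2 + b ^+ 2) * (a ^+ 2 + (t - b) ^+ 2) -
    a ^+ 2 * t ^+ 2 = (a ^+ 2 - (t - b) * b) ^+ 2 by ring.
exact: sqr_ge0.
Qed.

(** Stated along any sequence with modulus k so as to serve at both ends of the
    line. *)
Lemma resolvent_cvg0 (t : nat -> R) : (forall k, `|t k| = k%:R) ->
  ccvg0 (fun k => h (t k)).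
Proof.
move=> tk; pose N := a ^+ 2 + b ^+ 2.
have N_ge0 : 0 <= N by rewrite addr_ge0 ?sqr_ge0.
suff bound (x : R) k : (0 < k)%N -> x ^+ 2 * (a ^+ 2 + (t k - b) ^+ 2) <= 1 ->
    `|x| <= ((1 + N) / a) / k%:R.
  split; apply: cvg0_inv_bound => k k_gt0; apply: bound => //.
  - rewrite Re_h expr_div_n; set D := a ^+ 2 + _.
    have D_gt0 : 0 < D := den_gt0 _.
    have -> : a ^+ 2 / D ^+ 2 * D = a ^+ 2 / D by field; rewrite gt_eqF.
    by rewrite ler_pdivrMr // mul1r /D lerDl sqr_ge0.
  - rewrite Im_h sqrrN expr_div_n; set D := a ^+ 2 + _.
    have D_gt0 : 0 < D := den_gt0 _.
    have -> : (t k - b) ^+ 2 / D ^+ 2 * D = (t k - b) ^+ 2 / D.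
      by field; rewrite gt_eqF.
    by rewrite ler_pdivrMr // mul1r /D lerDr sqr_ge0.
move=> k_gt0 x_le; rewrite -mulrA -invfM ler_pdivlMr; last first.
  by rewrite mulr_gt0 // ltr0n.
have xak_ge0 : 0 <= `|x| * (a * k%:R).
  by rewrite mulr_ge0 ?normr_ge0 // mulr_ge0 ?ler0n // ltW.
rewrite -(@ler_pXn2r _ 2) // ?nnegrE ?addr_ge0 ?sqr_ge0 //.
rewrite !exprMn real_normK ?num_real // -(tk k) real_normK ?num_real //.
apply: (@le_trans _ _ (x ^+ 2 * (N * (a ^+ 2 + (t k - b) ^+ 2)))).
  by rewrite ler_wpM2l ?sqr_ge0 // den_growth.
rewrite mulrCA; apply: (@le_trans _ _ N); first by rewrite ler_piMr.
by nra.
Qed.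

(** The real part is a Poisson kernel, with an arctangent as antiderivative; the
    imaginary part has a logarithm as antiderivative, whose values at k and -k
    differ by a null sequence. *)
Lemma pv_resolvent : pv h pi%:C%C.
Proof.
have [c1 c2] := cderive_continuous cderive_resolvent.
have atan_pinfty c : atan ((k%:R + c) / a) @[k --> \oo] --> (pi / 2 : R).
  apply: (@cvg_comp _ _ _ (fun k : nat => k%:R : R)
    (fun r => atan ((r + c) / a)) \oo (pinfty_nbhs R)); first exact: cvgr_idn.
  apply: (@cvg_comp _ _ _ (fun r => (r + c) / a) atan (pinfty_nbhs R)
    (pinfty_nbhs R)); last exact: cvgy_atan.
  by apply: gt0_cvgMly; [rewrite invr_gt0|exact: cvg_addrr].
split; split => //.
- exists (fun w => atan ((w - b) / a)) => [w|].
    apply: is_derive_eq; rewrite Re_h /GRing.scale /=.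
    by field; rewrite !gt_eqF // -expr_div_n ltr_wpDr ?sqr_ge0.
  rewrite (_ : (fun k => _) = (fun k : nat =>
    atan ((k%:R + - b) / a) + atan ((k%:R + b) / a))); last first.
    by apply/funext => k; rewrite -opprD mulNr atanN opprK.
  by rewrite /= [X in _ --> X](splitr pi); apply: cvgD; exact: atan_pinfty.
- exists (fun w => - 2^-1 * ln (a ^+ 2 + (w - b) ^+ 2)) => [w|].
    have := is_derive1_ln (den_gt0 w) => dln.
    apply: is_derive_eq; rewrite Im_h /GRing.scale /=.
    by field; rewrite gt_eqF.
  rewrite /= -[X in _ --> X](mulr0 (2^-1 : R)) -(@ln1 R).
  pose r (k : nat) : R :=
    (a ^+ 2 + (- k%:R - b) ^+ 2) / (a ^+ 2 + (k%:R - b) ^+ 2).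
  rewrite (_ : (fun k => _) = (fun k : nat => 2^-1 * ln (r k))); last first.
    by apply/funext => k; rewrite ln_div ?posrE ?den_gt0 //; ring.
  apply: cvgM; first exact: cvg_cst.
  apply: continuous_cvg; first exact: continuous_ln.
  suff r0 : r k - 1 @[k --> \oo] --> (0 : R).
    have -> : r = (fun k => (r k - 1) + 1) by apply/funext => k; rewrite subrK.
    by rewrite -[X in _ --> X]add0r; apply: cvgD => //; exact: cvg_cst.
  apply: (@cvg0_inv_bound _ _
    (4 * `|b| * ((a ^+ 2 + b ^+ 2) / a ^+ 2))) => k k_gt0.
  rewrite /r; have k0 : 0 < k%:R :> R by rewrite ltr0n.
  set D := a ^+ 2 + (k%:R - b) ^+ 2; have D_gt0 : 0 < D := den_gt0 _.
  have -> : (a ^+ 2 + (- k%:R - b) ^+ 2) / D - 1 = 4 * b * k%:R / D.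
    rewrite -[X in _ - X](divff (lt0r_neq0 D_gt0)) /D -mulrBl.
    by congr (_ / _); ring.
  rewrite !normrM (gtr0_norm k0) (@gtr0_norm _ 4) // normfV (gtr0_norm D_gt0).
  rewrite -!mulrA !ler_wpM2l // ler_pdivrMr //.
  have -> : (a ^+ 2 + b ^+ 2) * (a ^- 2 * k%:R^-1) * D =
      (a ^+ 2 + b ^+ 2) * D / (a ^+ 2 * k%:R).
    by field; rewrite !gt_eqF.
  rewrite ler_pdivlMr ?mulr_gt0 ?exprn_gt0 // mulrCA -expr2.
  exact: den_growth.
Qed.

Lemma cderive_resolventX k : cderive (fun w => h w ^+ k.+1)
  (fun w => - 'i%C * k.+1%:R * h w ^+ k.+2).
Proof.
elim: k => [|k IHk].
  under eq_fun do rewrite expr1.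
  apply: cderive_eq cderive_resolvent _ => w.
  by rewrite mulr1 expr2.
under eq_fun do rewrite exprS.
apply: (cderive_eq (cderiveM cderive_resolvent IHk)) => w.
by rewrite !exprS -[k.+2%:R]natr1; ring.
Qed.

(** The antiderivative is a multiple of the next lower power, which still tends
    to 0 at both ends. *)
Lemma pv_resolventX k : pv (fun w => h w ^+ k.+2) 0.
Proof.
have hX_cvg0 (t : nat -> R) j : (forall k, `|t k| = k%:R) ->
    ccvg0 (fun k => h (t k) ^+ j.+1).
  move=> tE; elim: j => [|j IHj].
    by under eq_fun do rewrite expr1; exact: resolvent_cvg0.
  under eq_fun do rewrite exprS.
  by apply: ccvg0M IHj; exact: resolvent_cvg0.
pose c : R[i] := 'i%C / k.+1%:R.
have k0 : (k.+1%:R : R[i]) != 0 by rewrite pnatr_eq0.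
apply: (@pv_antiderivative (fun w => c * h w ^+ k.+1) _ _ _
  (cderive_resolventX k.+1)).
- apply: cderive_eq (cderiveM (cderive_cst c) (cderive_resolventX k)) _ => w.
  rewrite mul0r add0r; transitivity (- ('i%C ^+ 2) * h w ^+ k.+2).
    by rewrite /c; field.
  by rewrite sqr_i opprK mul1r.
- by apply: ccvg0Z; apply: hX_cvg0 => j; rewrite normr_nat.
- by apply: ccvg0Z; apply: hX_cvg0 => j; rewrite normrN normr_nat.
Qed.

End ResolventIntegrals.

Section PartialFractions.
Variable R : realType.

(** If all poles coincide this is a power of a resolvent.  Otherwise two
    distinct poles l and m are separated by
    1/((s-l)(s-m)) = (1/(s-l) - 1/(s-m)) / (l-m), which leaves two products
    with one factor less; for two factors the two values pi cancel. *)
Lemma pv_prod_resolvent (ls : seq R[i]) :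
  {in ls, forall l, complex.Re l < 0} -> (1 < size ls)%N ->
  pv (fun w : R => \prod_(l <- ls) ((0 +i* w)%C - l)^-1) 0.
Proof.
have [n] := ubnP (size ls); elim: n ls => // n IHn [|l ls] //= ls_n lsP ls_gt0.
have lP : complex.Re l < 0 by apply: lsP; rewrite mem_head.
have [/all_pred1P ls_nseq|/allPn[m m_ls m_neq_l]] := boolP (all (pred1 l) ls).
  rewrite ls_nseq; case: (ls) ls_gt0 => //= _ ls' _.
  apply: pv_ext (pv_resolventX lP (size ls')) => w.
  by rewrite !big_cons big_nseq iter_mulr_1 !exprS.
have mP : complex.Re m < 0 by apply: lsP; rewrite inE m_ls orbT.
pose rest := rem m ls.
have sz_rest : size ls = (size rest).+1.
  by rewrite size_rem // prednK // (leq_trans _ ls_gt0).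
have lm0 : l - m != 0 by rewrite subr_eq0 eq_sym.
have neq0 (k : R[i]) (w : R) : complex.Re k < 0 -> (0 +i* w)%C - k != 0.
  by move=> k_lt0; exact: resolvent_neq0.
(* The poles l and m are separated: each remaining product misses one. *)
have split w : \prod_(k <- l :: ls) ((0 +i* w)%C - k)^-1 =
    (l - m)^-1 * \prod_(k <- l :: rest) ((0 +i* w)%C - k)^-1 +
    - (l - m)^-1 * \prod_(k <- m :: rest) ((0 +i* w)%C - k)^-1.
  rewrite !big_cons (perm_big _ (perm_to_rem m_ls)) big_cons /=.
  by field; rewrite lm0 !neq0.
apply: pv_ext (fun w => esym (split w)) _.
have [rest0|rest_gt0] := posnP (size rest).
  have -> : rest = [::] by apply/size0nil.
  have -> : 0 = (l - m)^-1 * pi%:C%C + - (l - m)^-1 * pi%:C%C by ring.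
  apply: pvD; apply: pvZ; under eq_fun do rewrite big_seq1; exact: pv_resolvent.
have -> : 0 = (l - m)^-1 * 0 + - (l - m)^-1 * 0 :> R[i] by rewrite !mulr0 addr0.
apply: pvD; apply: pvZ; apply: IHn => //=; rewrite -?sz_rest //.
- move=> k; rewrite inE => /predU1P[-> //|/mem_rem k_ls].
  by apply: lsP; rewrite inE k_ls orbT.
- move=> k; rewrite inE => /predU1P[-> //|/mem_rem k_ls].
  by apply: lsP; rewrite inE k_ls orbT.
Qed.

End PartialFractions.

(** * Principal values of matrix resolvents *)

Section TraceForms.
Variable R : realType.

(** The conjugate transpose, in the form in which [h2norm] spells it. *)
Definition hermx k l (M : 'M[R[i]]_(k, l)) : 'M[R[i]]_(l, k) :=
  (map_mx (@conjc R) M)^T.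

Lemma hermxM k l j (M : 'M[R[i]]_(k, l)) (P : 'M[R[i]]_(l, j)) :
  hermx (M *m P) = hermx P *m hermx M.
Proof. by rewrite /hermx map_mxM trmx_mul. Qed.

Lemma hermx_cplx k l (M : 'M[R]_(k, l)) : hermx (cplxmx M) = cplxmx M^T.
Proof. by apply/matrixP => i j; rewrite !mxE conjc_real. Qed.

Lemma cplxmxM k l j (M : 'M[R]_(k, l)) (P : 'M[R]_(l, j)) :
  cplxmx (M *m P) = cplxmx M *m cplxmx P.
Proof. exact: map_mxM. Qed.

Lemma mxtrace_cplx k (M : 'M[R]_k) : \tr (cplxmx M) = (\tr M)%:C%C.
Proof. exact: trace_map_mx. Qed.

Lemma mxtrace_hermx k (M : 'M[R[i]]_k) : \tr (hermx M) = conjc (\tr M).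
Proof. by rewrite /hermx mxtrace_tr trace_map_mx. Qed.

Lemma complex_Re_sum (I : finType) (F : I -> R[i]) :
  complex.Re (\sum_i F i) = \sum_i complex.Re (F i).
Proof. by apply: (big_morph _ (@complex_ReD R)). Qed.

Lemma Re_mxtrace_hermx_ge0 k l (T : 'M[R[i]]_(k, l)) :
  0 <= complex.Re (\tr (hermx T *m T)).
Proof.
rewrite /mxtrace complex_Re_sum sumr_ge0 // => i _.
rewrite mxE complex_Re_sum sumr_ge0 // => j _; rewrite !mxE.
by case: (T j i) => x y /=; rewrite mulNr opprK -!expr2 addr_ge0 ?sqr_ge0.
Qed.

Lemma mxtrace_mul_tr_ge0 k l (T : 'M[R]_(k, l)) : 0 <= \tr (T *m T^T).
Proof.
rewrite /mxtrace sumr_ge0 // => i _; rewrite mxE sumr_ge0 // => j _.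
by rewrite mxE -expr2 sqr_ge0.
Qed.

Lemma mxtrace_mul_tr_eq0 k l (T : 'M[R]_(k, l)) : \tr (T *m T^T) = 0 -> T = 0.
Proof.
have sq_ge0 i j : true -> 0 <= T i j * T^T j i.
  by move=> _; rewrite mxE -expr2 sqr_ge0.
have row_ge0 i : true -> 0 <= (T *m T^T) i i.
  by move=> _; rewrite mxE sumr_ge0 // => j; exact: sq_ge0.
move=> /eqP; rewrite /mxtrace psumr_eq0 // => /allP h.
apply/matrixP => i j; rewrite mxE.
have /eqP := h i (mem_index_enum i); rewrite mxE => /eqP.
rewrite psumr_eq0 => [/allP h'|]; last exact: sq_ge0.
have := h' j (mem_index_enum j).
by rewrite mxE mulf_eq0 orbb => /eqP.
Qed.

End TraceForms.

Section StableResolvent.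
Variables (R : realType) (N : nat) (A : 'M[R]_N).
Hypothesis A_stable : stable_mx A.

Lemma stable_resolvent_unit (s : R[i]) : 0 <= complex.Re s ->
  s%:M - cplxmx A \in unitmx.
Proof.
move=> s_ge0; rewrite -row_free_unit -kermx_eq0; apply/negPn/negP => ker0.
have /A_stable : eigenvalue (cplxmx A) s.
  rewrite /eigenvalue /eigenspace -oppr_eq0.
  apply: contra ker0; rewrite oppr_eq0 => /eqP ker0.
  rewrite kermx_eq0 row_free_unit -opprB -scaleN1r unitmxZ ?unitrN1 //.
  by rewrite -row_free_unit -kermx_eq0 ker0.
by rewrite ltNge s_ge0.
Qed.

Definition resolvent (w : R) : 'M[R[i]]_N :=
  invmx ((0 +i* w)%C%:M - cplxmx A).

Lemma mulmx_resolvent w :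
  ((0 +i* w)%C%:M - cplxmx A) *m resolvent w = 1%:M.
Proof. by rewrite mulmxV // stable_resolvent_unit. Qed.

Lemma resolvent_mulmx w :
  resolvent w *m ((0 +i* w)%C%:M - cplxmx A) = 1%:M.
Proof. by rewrite mulVmx // stable_resolvent_unit. Qed.

Let step (M : 'M[R[i]]_N) (l : R[i]) := M *m (cplxmx A - l%:M).

(** By the Cayley-Hamilton theorem the list of eigenvalues works.  The left fold
    avoids a product of matrices whose size need not be a successor. *)
Lemma stable_annihilator : exists2 ls : seq R[i],
  {in ls, forall l, complex.Re l < 0} & forall M, foldl step M ls = 0.
Proof.
rewrite {}/step; case: N A A_stable => [|n] B B_stable.
  by exists [::] => // M; apply/matrixP => -[].
have [ls charE] := closed_field_poly_normal (char_poly (cplxmx B)).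
have /monicP lead1 := char_poly_monic (cplxmx B).
rewrite lead1 scale1r in charE; exists ls => [l l_ls|M].
  by apply: B_stable; rewrite eigenvalue_root_char charE root_prod_XsubC.
have : M * \prod_(l <- ls) (cplxmx B - l%:M) = 0.
  have := Cayley_Hamilton (cplxmx B); rewrite charE rmorph_prod /=.
  under eq_bigr do rewrite rmorphB /= horner_mx_X horner_mx_C.
  by move=> ->; rewrite mulr0.
elim: (ls) M => [|l s IHs] M /=; first by rewrite big_nil mulr1.
by rewrite big_cons mulrA => /IHs.
Qed.

(** Iterate G = (jw - l)^-1 (1 + (A - l) G) over the list of eigenvalues: the
    remainder is annihilated, every term but the first has at least two scalar
    factors and contributes 0, and the first contributes pi. *)
Lemma pv_trace_resolvent (M : 'M[R[i]]_N) :
  pv (fun w => \tr (M *m resolvent w)) (pi%:C%C * \tr M).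
Proof.
have [ls lsP ls0] := stable_annihilator.
(* The list ms collects the scalar factors already split off. *)
suff gen ms : {in ms, forall l, complex.Re l < 0} ->
    pv (fun w => (\prod_(m <- ms) ((0 +i* w)%C - m)^-1) *
                 \tr (M *m resolvent w))
       (if ms is [::] then pi%:C%C * \tr M else 0).
  by apply: pv_ext (gen [::] _) => // w; rewrite big_nil mul1r.
move: (ls0 M) => {ls0}.
elim: ls M ms lsP => [|l ls IHls] M ms lsP /= foldM msP.
  rewrite foldM mxtrace0 mulr0 (_ : (if ms is [::] then 0 else 0) = 0) //.
    by apply: pv_ext (pv0 R) => w; rewrite mul0mx mxtrace0 mulr0.
  by case: ms {msP}.
have l_lt0 : complex.Re l < 0 by apply: lsP; rewrite mem_head.
have lmsP : {in l :: ms, forall k, complex.Re k < 0}.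
  by move=> k; rewrite inE => /predU1P[->|/msP].
have {IHls} := IHls (step M l) (l :: ms) _ foldM lmsP.
have lsP' : {in ls, forall k, complex.Re k < 0}.
  by move=> k k_ls; apply: lsP; rewrite inE k_ls orbT.
move=> /(_ lsP') pvM'.
have pvl : pv (fun w : R => \prod_(m <- l :: ms) ((0 +i* w)%C - m)^-1)
    (if ms is [::] then pi%:C%C else 0).
  case: ms {msP pvM'} lmsP => [|m ms] lmsP; last exact: pv_prod_resolvent.
  by under eq_fun do rewrite big_seq1; exact: pv_resolvent.
have -> : (if ms is [::] then pi%:C%C * \tr M else 0) =
    \tr M * (if ms is [::] then pi%:C%C else 0) + 0.
  by case: (ms) => [|_ _]; rewrite addr0 ?mulr0 // mulrC.
apply: pv_ext (pvD (pvZ (\tr M) pvl) pvM') => w.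
have jwl : (0 +i* w)%C - l != 0 by exact: resolvent_neq0.
rewrite big_cons /step; set p := \prod_(_ <- _) _.
have -> : M *m (cplxmx A - l%:M) =
    ((0 +i* w)%C - l) *: M - M *m ((0 +i* w)%C%:M - cplxmx A).
  rewrite !mulmxBr !mul_mx_scalar scalerBl opprB.
  by rewrite [RHS]addrC addrA subrK.
rewrite mulmxBl -mulmxA mulmx_resolvent mulmx1 -scalemxAl.
by rewrite raddfB /= mxtraceZ; field.
Qed.

(** Since M = (jw - A) E + E (jw - A)^H, the integrand splits into G E and
    E G^H, and the second is the conjugate of a term of the first kind. *)
Lemma pv_lyapunov (E M Z : 'M[R]_N) : A *m E + E *m A^T = - M ->
  pv (fun w => \tr (resolvent w *m cplxmx M *m hermx (resolvent w) *m cplxmx Z))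
     (2 * pi * \tr (E *m Z))%:C%C.
Proof.
move=> AE.
have ident w : resolvent w *m cplxmx M *m hermx (resolvent w) =
    cplxmx E *m hermx (resolvent w) + resolvent w *m cplxmx E.
  set S := (0 +i* w)%C%:M - cplxmx A.
  have hS : hermx S = - (0 +i* w)%C%:M - cplxmx A^T.
    rewrite -hermx_cplx /hermx /S map_mxB map_scalar_mx linearB /=.
    have -> : (0 -i* w)%C = - (0 +i* w)%C.
      by apply: complex_eq; rewrite /= ?oppr0.
    by rewrite tr_scalar_mx raddfN.
  have ME : cplxmx M = S *m cplxmx E + cplxmx E *m hermx S.
    rewrite hS -[M]opprK -AE /S mulmxBl mulmxBr mulmxN.
    rewrite -!cplxmxM mul_scalar_mx mul_mx_scalar.
    rewrite addrACA subrr add0r -opprD -map_mxD -map_mxN //.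
  rewrite ME mulmxDr mulmxDl mulmxA resolvent_mulmx mul1mx.
  by rewrite -!mulmxA -hermxM resolvent_mulmx /hermx map_mx1 trmx1 mulmx1.
have -> : (2 * pi * \tr (E *m Z))%:C%C =
    conjc (pi%:C%C * \tr (cplxmx (Z *m E)^T)) + pi%:C%C * \tr (cplxmx (E *m Z)).
  rewrite !mxtrace_cplx mxtrace_tr -!rmorphM conjc_real (mxtrace_mulC Z).
  by rewrite -rmorphD; congr (_%:C%C); ring.
apply: pv_ext
  (pvD (pv_conj (pv_trace_resolvent _)) (pv_trace_resolvent _)) => w.
rewrite ident mulmxDl mxtraceD -mxtrace_hermx hermxM hermx_cplx trmxK.
congr (_ + _).
  by rewrite [LHS]mxtrace_mulC cplxmxM -(mulmxA (cplxmx Z)) [LHS]mxtrace_mulC.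
by rewrite [LHS]mxtrace_mulC cplxmxM mulmxA.
Qed.

End StableResolvent.

(** * The H2 norm and the Lyapunov equation *)

(** Monotone convergence over the intervals [-k, k] turns the principal value of
    a nonnegative function into its Lebesgue integral. *)
Lemma Rintegral_pv (R : realType) (f : R -> R) (c : R) : pv_real f c ->
  (forall w, 0 <= f w) -> (\int[lebesgue_measure]_(w in setT) f w)%R = c.
Proof.
move=> [fc [F dF Fc]] f_ge0.
pose I (k : nat) : set R := [set` `[- k%:R, k%:R]].
have I_mono : {homo I : n m / (n <= m)%N >-> (n <= m)%O}.
  move=> n m nm; apply/subsetPset => x; rewrite /I /= !in_itv /=.
  move=> /andP[nx xn]; have : n%:R <= m%:R :> R by rewrite ler_nat.
  by move=> nm'; apply/andP; split; lra.
have IT : \bigcup_k I k = setT.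
  apply/seteqP; split => // x _; exists (Num.truncn `|x|).+1 => //.
  rewrite /I /= in_itv /= -ler_norml ltW //.
  by have /andP[] := truncn_itv (normr_ge0 x).
have fI k : (\int[lebesgue_measure]_(x in I k) (f x)%:E =
    (F k%:R - F (- k%:R))%:E)%E.
  case: k => [|k].
    by rewrite /I oppr0 set_itv1 integral_set1 subrr.
  rewrite (@continuous_FTC2 _ f F).
  - by rewrite EFinB.
  - by rewrite gtrN // ltr0n.
  - exact: continuous_subspaceT.
  - have dF' x : derivable F x 1 by have [] := dF x.
    have Fcont : continuous F.
      by move=> x; apply: differentiable_continuous; apply/derivable1_diffP.
    split => //; first by apply: cvg_at_right_filter; exact: Fcont.
    by apply: cvg_at_left_filter; exact: Fcont.
  - by move=> x _; rewrite derive1E; have [_ ->] := dF x.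
have mf : measurable_fun setT f by exact: continuous_measurable_fun.
have mI k : measurable_fun (I k) (EFin \o f).
  by apply/measurable_EFinP; exact: measurable_funTS.
have int_cvg : (\int[lebesgue_measure]_(x in I k) (f x)%:E)%E @[k --> \oo] -->
    (\int[lebesgue_measure]_(x in setT) (f x)%:E)%E.
  rewrite -IT; apply: ge0_nondecreasing_set_cvg_integral => //.
  - by move=> i; exact: measurable_itv.
  - by move=> i x _; rewrite lee_fin.
rewrite (funext fI) in int_cvg.
rewrite /Rintegral (_ : (\int[lebesgue_measure]_x _)%E = c%:E) //.
apply: (@cvg_unique _ (@ereal_hausdorff R)) int_cvg _.
by apply: cvg_EFin => //; exact: nearW.
Qed.

Section LyapunovEquation.
Variables (R : realType) (N : nat) (A : 'M[R]_N).
Hypothesis A_stable : stable_mx A.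

(** With M = 0 the integrand of [pv_lyapunov] vanishes, so tr (E Z) has both
    signs for every Z. *)
Lemma lyapunov_kernel0 (E : 'M[R]_N) : A *m E + E *m A^T = 0 -> E = 0.
Proof.
move=> AE0; have AE : A *m E + E *m A^T = - 0 by rewrite oppr0.
have tr_ge0 Z : 0 <= \tr (E *m Z).
  have [pvRe _] := pv_lyapunov A_stable Z AE.
  have : 0 <= 2 * pi * \tr (E *m Z).
    apply: pv_real_ge0 pvRe _ => w.
    by rewrite /cplxmx map_mx0 mulmx0 !mul0mx mxtrace0.
  by rewrite pmulr_rge0 // mulr_gt0 // pi_gt0.
apply: mxtrace_mul_tr_eq0; apply/eqP; rewrite eq_le tr_ge0 andbT.
by have := tr_ge0 (- E^T); rewrite mulmxN raddfN oppr_ge0.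
Qed.

Variables (k l : nat) (B : 'M[R]_(N, l)) (C : 'M[R]_(k, N)) (E : 'M[R]_N).
Hypothesis lyapE : A *m E + E *m A^T = - (B *m B^T).

Let T (w : R) := cplxmx C *m resolvent A w *m cplxmx B.

Lemma pv_h2_integrand :
  pv_real (fun w => complex.Re (\tr (hermx (T w) *m T w)))
    (2 * pi * \tr (C *m E *m C^T)).
Proof.
have [pvRe _] := pv_lyapunov A_stable (C^T *m C) lyapE.
rewrite mulmxA mxtrace_mulC mulmxA in pvRe.
move: pvRe; congr (pv_real _ _); apply/funext => w; congr complex.Re.
rewrite /T [RHS]mxtrace_mulC !hermxM !hermx_cplx !cplxmxM -!mulmxA.
by rewrite [RHS]mxtrace_mulC -!mulmxA.
Qed.

Lemma lyapunov_trace_ge0 : 0 <= \tr (C *m E *m C^T).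
Proof.
have := pv_real_ge0 pv_h2_integrand (fun w => Re_mxtrace_hermx_ge0 _).
by rewrite pmulr_rge0 // mulr_gt0 // pi_gt0.
Qed.

Lemma h2norm_lyapunov :
  h2norm (fun s => cplxmx C *m invmx (s%:M - cplxmx A) *m cplxmx B) =
  Num.sqrt (\tr (C *m E *m C^T)).
Proof.
rewrite /h2norm; congr Num.sqrt.
rewrite (Rintegral_pv pv_h2_integrand (fun w => Re_mxtrace_hermx_ge0 _)).
by rewrite mulrA mulVf ?mul1r // mulf_neq0 // gt_eqF // pi_gt0.
Qed.

End LyapunovEquation.

(** * Positive semidefinite matrices and their square roots *)

Section PositiveSemidefinite.
Variable R : realType.

(** The cross terms between the real and imaginary parts of v are purely
    imaginary. *)
Lemma Re_quadratic_form n (M : 'M[R]_n) (v : 'rV[R[i]]_n) :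
  let a := map_mx (@complex.Re R) v in let b := map_mx (@complex.Im R) v in
  complex.Re ((v *m cplxmx M *m hermx v) 0 0) =
  (a *m M *m a^T) 0 0 + (b *m M *m b^T) 0 0.
Proof.
move=> a b; rewrite !mxE complex_Re_sum -big_split /=; apply: eq_bigr => j _.
have -> : (v *m cplxmx M) 0 j = ((a *m M) 0 j +i* (b *m M) 0 j)%C.
  rewrite !mxE; apply: complex_eq => /=.
    rewrite complex_Re_sum; apply: eq_bigr => k _.
    by rewrite !mxE complex_ReM /= mulr0 subr0.
  rewrite (big_morph _ (@complex_ImD R) (erefl : complex.Im 0 = 0)).
  apply: eq_bigr => k _.
  by rewrite !mxE complex_ImM /= mulr0 add0r.
rewrite !mxE complex_ReM /=.
by case: (v 0 j) => x y /=; rewrite mulrN opprK.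
Qed.

Lemma psdmx_row n (M : 'M[R]_n) (x : 'rV[R]_n) : psdmx M ->
  0 <= (x *m M *m x^T) 0 0.
Proof. by move=> [_ /(_ x^T)]; rewrite trmxK. Qed.

Lemma psdmx_gram n k (S : 'M[R]_(n, k)) : psdmx (S *m S^T).
Proof.
split=> [|x]; first by rewrite trmx_mul trmxK.
have -> : x^T *m (S *m S^T) *m x = (x^T *m S) *m (x^T *m S)^T.
  by rewrite trmx_mul trmxK !mulmxA.
by rewrite mxE sumr_ge0 // => j _; rewrite [X in _ * X]mxE -expr2 sqr_ge0.
Qed.

Lemma interpolation (F : fieldType) (f : F -> F) (s : seq F) :
  exists p : {poly F}, {in s, forall x, p.[x] = f x}.
Proof.
elim: s => [|y s [p pf]]; first by exists 0.
have [ys|ys] := boolP (y \in s).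
  by exists p => x; rewrite inE => /predU1P[->|]; exact: pf.
pose g : {poly F} := \prod_(z <- s) ('X - z%:P).
have gy : g.[y] != 0 by rewrite -[_ == 0]/(root g y) root_prod_XsubC.
exists (p + ((f y - p.[y]) / g.[y]) *: g) => x; rewrite inE hornerD hornerZ.
have [-> _|xy /= xs] := eqVneq x y; first by rewrite divfK // addrC subrK.
by have /eqP -> : root g x; rewrite ?root_prod_XsubC // mulr0 addr0 pf.
Qed.

Lemma trmx_horner_sym n (M : 'M[R]_n.+1) (p : {poly R}) : M^T = M ->
  (horner_mx M p)^T = horner_mx M p.
Proof.
move=> Msym; elim/poly_ind: p => [|p c IHp]; first by rewrite rmorph0 trmx0.
rewrite rmorphD rmorphM /= horner_mx_X horner_mx_C linearD /= tr_scalar_mx.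
rewrite [(_ * _)^T]trmx_mul IHp Msym; congr (_ + _).
by apply: (@comm_mx_horner _ _ M M p).
Qed.

(** Over the complex numbers M is unitarily diagonalizable with nonnegative real
    eigenvalues.  A real polynomial p that interpolates the fourth root at
    these gives a symmetric real T = p(M) with T^4 = M.  Passing through the
    fourth root makes the square root T T^T visibly positive semidefinite. *)
Lemma psdmx_sqrt_exists n (M : 'M[R]_n) : psdmx M ->
  exists S : 'M[R]_n, psdmx S /\ S *m S = M.
Proof.
case: n M => [|n] M psdM.
  exists 0; split; last by rewrite mulmx0 [RHS]flatmx0.
  by split=> [|x]; rewrite ?trmx0 ?mulmx0 ?mul0mx ?mxE.
have [Msym _] := psdM; pose cM := cplxmx M.
have cM_herm : map_mx Num.conj cM^T = cM.
  by rewrite -map_trmx -/(hermx _) hermx_cplx Msym.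
have /orthomx_spectralP : cM \is normalmx by apply/normalmxP; rewrite cM_herm.
set P := spectralmx cM; set d := spectral_diag cM => cME.
have P_unit : P \in unitmx by exact: spectral_unit.
have dE i : d 0 i = (complex.Re (d 0 i))%:C%C.
  have /hermitian_spectral_diag_real/mxOverP : cM \is hermsymmx.
    by apply/is_hermitianmxP; rewrite expr0 scale1r cM_herm.
  by move=> /(_ 0 i) /RRe_real.
have d_ge0 i : 0 <= complex.Re (d 0 i).
  have -> : d 0 i = (row i P *m cM *m hermx (row i P)) 0 0.
    have -> : d 0 i = (P *m cM *m invmx P) i i.
      by rewrite cME !mulmxA mulmxV // mul1mx mulmxK // mxE eqxx mulr1n.
    rewrite invmx_unitary ?spectral_unitarymx // -row_mul !mxE.
    by apply: eq_bigr => k _; rewrite !mxE.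
  by rewrite Re_quadratic_form addr_ge0 // psdmx_row.
pose fourth (x : R) := Num.sqrt (Num.sqrt x).
have [p pE] := interpolation fourth [seq complex.Re (d 0 i) | i : 'I_n.+1].
have cp4 : horner_mx cM (map_poly (real_complex R) (p ^+ 4)) = cM.
  rewrite {1}cME (horner_mx_uconjC _ _ P_unit) horner_mx_diag.
  suff -> : map_mx (horner (map_poly (real_complex R) (p ^+ 4))) d = d by [].
  apply/matrixP => i j; rewrite ord1 !mxE dE horner_map; congr _%:C%C.
  rewrite horner_exp pE; last exact: (codom_f (fun i => complex.Re (d 0 i)) j).
  rewrite /fourth.
  by rewrite -[4%N]/(2 * 2)%N exprM !sqr_sqrtr ?sqrtr_ge0 //.
have p4 : horner_mx M (p ^+ 4) = M.
  apply: (@map_mx_inj _ _ (real_complex R)).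
  by apply: etrans cp4; rewrite map_horner_mx.
pose T := horner_mx M p; have Tsym : T^T = T by exact: trmx_horner_sym.
exists (T *m T); split; first by rewrite -[X in _ *m X]Tsym; exact: psdmx_gram.
by rewrite -[RHS]p4 rmorphXn /= -/T -[4%N]/(2 + 2)%N exprD expr2.
Qed.

Lemma psdmx_factor n (M : 'M[R]_n) : psdmx M ->
  exists S : 'M[R]_n, M = S *m S^T.
Proof.
move=> /psdmx_sqrt_exists[S [[Ssym _] SS]].
by exists S; rewrite Ssym SS.
Qed.

Lemma sqrtmxP n (M : 'M[R]_n) : psdmx M ->
  psdmx (sqrtmx M) /\ sqrtmx M *m sqrtmx M = M.
Proof. by move=> /psdmx_sqrt_exists; exact: xgetPex. Qed.

Lemma pdmx_psd n (M : 'M[R]_n) : pdmx M -> psdmx M.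
Proof.
move=> [Msym Mpos]; split=> // x; have [->|/Mpos /ltW //] := eqVneq x 0.
by rewrite mulmx0 mxE.
Qed.

Lemma pdmx_unit n (M : 'M[R]_n) : pdmx M -> M \in unitmx.
Proof.
move=> [Msym Mpos]; rewrite -row_free_unit -kermx_eq0.
apply/negPn/negP => /rowV0Pn[v /sub_kermxP vM v0].
have vT0 : v^T != 0 by rewrite -trmx0 (inj_eq trmx_inj).
by have := Mpos _ vT0; rewrite trmxK vM mul0mx mxE ltxx.
Qed.

Lemma sqrtmx_unit n (M : 'M[R]_n) : pdmx M -> sqrtmx M \in unitmx.
Proof.
move=> Mpd; have [_ SS] := sqrtmxP (pdmx_psd Mpd).
by have := pdmx_unit Mpd; rewrite -{1}SS unitmx_mul => /andP[].
Qed.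

Lemma psdmx_congr n k (M : 'M[R]_n) (S : 'M[R]_(n, k)) : psdmx M ->
  psdmx (S^T *m M *m S).
Proof.
move=> [Msym M_ge0]; split=> [|x]; first by rewrite !trmx_mul trmxK Msym mulmxA.
by have := M_ge0 (S *m x); rewrite trmx_mul !mulmxA.
Qed.

Lemma psdmx_scale n (M : 'M[R]_n) c : 0 <= c -> psdmx M -> psdmx (c *: M).
Proof.
move=> c_ge0 [Msym M_ge0]; split=> [|x]; first by rewrite linearZ /= Msym.
by rewrite -scalemxAr -scalemxAl mxE mulr_ge0.
Qed.

Lemma psdmx_trace_ge0 n (M : 'M[R]_n) : psdmx M -> 0 <= \tr M.
Proof. by move=> /psdmx_factor[S ->]; exact: mxtrace_mul_tr_ge0. Qed.

(** With M = S S^T the trace is the squared Frobenius norm of C S. *)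
Lemma psdmx_trace_eq0 n k (M : 'M[R]_n) (C : 'M[R]_(k, n)) : psdmx M ->
  \tr (C *m M *m C^T) = 0 -> C *m M = 0.
Proof.
move=> /psdmx_factor[S ->]; rewrite mulmxA -(mulmxA _ S^T) -trmx_mul.
by move=> /mxtrace_mul_tr_eq0 ->; rewrite mul0mx.
Qed.

End PositiveSemidefinite.

(** * Lyapunov solutions, stability and observability *)

Section LyapunovSolution.
Variables (R : realType) (N : nat).
Implicit Types (A M X : 'M[R]_N).

(** The matrix of X |-> A X + X A^T acting on vectorized matrices. *)
Definition lyapunov_mx A : 'M[R]_(N * N) := lin_mulmx A + lin_mulmxr A^T.

(** The inverse is written with the adjugate so that every entry is visibly a
    rational function of the entries of A and M. *)
Definition lyapunov_sol A M : 'M[R]_N :=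
  vec_mx (mxvec M *m ((\det (lyapunov_mx A))^-1 *: \adj (lyapunov_mx A))).

Lemma mxvec_lyapunov A X :
  mxvec X *m lyapunov_mx A = mxvec (A *m X + X *m A^T).
Proof. by rewrite mulmxDr !mul_vec_lin -linearD. Qed.

Lemma lyapunov_mx_unit A : stable_mx A -> lyapunov_mx A \in unitmx.
Proof.
move=> A_stable; rewrite -row_free_unit -kermx_eq0.
apply/negPn/negP => /rowV0Pn[v /sub_kermxP]; rewrite -[v]vec_mxK.
rewrite mxvec_lyapunov => /eqP; rewrite mxvec_eq0 => /eqP.
by move=> /(lyapunov_kernel0 A_stable) ->; rewrite linear0 eqxx.
Qed.

Lemma lyapunov_solP A M : stable_mx A ->
  A *m lyapunov_sol A M + lyapunov_sol A M *m A^T = M.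
Proof.
move=> /lyapunov_mx_unit L_unit; apply: (can_inj mxvecK).
rewrite -mxvec_lyapunov vec_mxK -mulmxA.
have -> : (\det (lyapunov_mx A))^-1 *: \adj (lyapunov_mx A) =
    invmx (lyapunov_mx A) by rewrite /invmx L_unit.
by rewrite mulVmx // mulmx1.
Qed.

Lemma lyapunov_unique A M X X' : stable_mx A ->
  A *m X + X *m A^T = M -> A *m X' + X' *m A^T = M -> X = X'.
Proof.
move=> A_stable XM X'M; apply/eqP; rewrite -subr_eq0; apply/eqP.
apply: (lyapunov_kernel0 A_stable).
by rewrite mulmxBr mulmxBl addrACA -opprD XM X'M subrr.
Qed.

Lemma lyapunov_psd A M X : stable_mx A -> psdmx M ->
  A *m X + X *m A^T = - M -> psdmx X.
Proof.
move=> A_stable psdM lyapX; have [Msym _] := psdM; split=> [|x].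
  apply: (lyapunov_unique A_stable _ lyapX).
  by rewrite -[in RHS]Msym -linearN -lyapX linearD /= !trmx_mul trmxK addrC.
have [S MS] := psdmx_factor psdM; rewrite MS in lyapX.
have := lyapunov_trace_ge0 A_stable x^T lyapX.
by rewrite trmxK /mxtrace big_ord1.
Qed.

(** For a left eigenvector v of A at z, the form v (A X + X A^T) v^H is
    2 Re z (v X v^H); it is negative while v X v^H is nonnegative. *)
Lemma lyapunov_stable A X : psdmx X ->
  (forall v : 'rV[R]_N, v != 0 ->
     0 < (v *m (- (A *m X + X *m A^T)) *m v^T) 0 0) ->
  stable_mx A.
Proof.
move=> psdX Zpos z /eigenvalueP[v vA v0]; set Z := - _ in Zpos.
have form : (v *m cplxmx Z *m hermx v) =
    (- (z + conjc z)) *: (v *m cplxmx X *m hermx v).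
  have -> : cplxmx Z = - (cplxmx A *m cplxmx X + cplxmx X *m cplxmx A^T).
    by rewrite /Z -!cplxmxM -map_mxD -map_mxN.
  rewrite mulmxN mulNmx scaleNr; congr (- _).
  rewrite mulmxDr mulmxDl !mulmxA vA -hermx_cplx -(mulmxA _ (hermx _)).
  rewrite -hermxM vA scalerDl -!scalemxAl; congr (_ + _).
  by rewrite /hermx map_mxZ linearZ /= -scalemxAr.
have := congr1 (fun Y : 'M[R[i]]_1 => complex.Re (Y 0 0)) form.
rewrite [X in _ = complex.Re X]mxE complex_ReM !Re_quadratic_form.
set a := map_mx _ v; set b := map_mx _ v.
have Xa : 0 <= (a *m X *m a^T) 0 0 by exact: psdmx_row.
have Xb : 0 <= (b *m X *m b^T) 0 0 by exact: psdmx_row.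
have Z_ge0 (w : 'rV[R]_N) : 0 <= (w *m Z *m w^T) 0 0.
  have [->|w0] := eqVneq w 0; first by rewrite trmx0 mulmx0 mxE.
  exact: ltW (Zpos w w0).
have Zab : 0 < (a *m Z *m a^T) 0 0 + (b *m Z *m b^T) 0 0.
  have [a0|a0] := eqVneq a 0; last by rewrite ltr_wpDr // Zpos.
  have [b0|b0] := eqVneq b 0; last by rewrite ltr_wpDl // Zpos.
  case/negP: v0; apply/eqP/matrixP => i j; apply: complex_eq.
    by have := congr1 (fun Y : 'rV_N => Y i j) a0; rewrite !mxE.
  by have := congr1 (fun Y : 'rV_N => Y i j) b0; rewrite !mxE.
case: (z) => x y /=; rewrite subrr oppr0 mul0r subr0 => E.
rewrite E in Zab; nra.
Qed.

(** The Gramian X with A X + X A^T = -1 remains a certificate of stability near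
    A, because the perturbed left-hand side stays negative definite. *)
Lemma stable_mx_open A : stable_mx A -> exists2 e : R, 0 < e &
  forall B : 'M[R]_N, (forall i j, `|B i j - A i j| < e) -> stable_mx B.
Proof.
move=> A_stable; have lyapX := lyapunov_solP (- 1%:M) A_stable.
move: (lyapunov_sol _ _) lyapX => X lyapX.
have psdX : psdmx X.
  apply: (lyapunov_psd A_stable _ lyapX).
  by rewrite -[1%:M]mul1mx -{2}trmx1; exact: psdmx_gram.
pose c := \sum_i \sum_j `|X i j|; pose d : R := 1 + c * N%:R.
have c_ge0 : 0 <= c by rewrite sumr_ge0 // => i _; rewrite sumr_ge0.
have d_gt0 : 0 < d by rewrite ltr_pwDl // mulr_ge0.
(* A perturbation of the entries by less than 1 / (4 d) moves each of the two
   terms of the form by at most a quarter of the squared norm of v. *)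
exists (4 * d)^-1; first by rewrite invr_gt0 mulr_gt0.
move=> B AB; apply: (lyapunov_stable psdX) => v v0.
pose D := (B - A) *m X.
have DE i j : `|D i j| <= (4 * d)^-1 * c.
  rewrite mxE (le_trans (ler_norm_sum _ _ _)) // /c mulr_sumr ler_sum // => k _.
  rewrite normrM !mxE ler_pM //; first exact: ltW.
  by rewrite (bigD1 j) //= lerDl sumr_ge0.
pose n2 := \sum_i v 0 i ^+ 2.
have n2_gt0 : 0 < n2.
  rewrite lt_def sumr_ge0 ?andbT => [|i _]; last exact: sqr_ge0.
  apply: contra v0; rewrite psumr_eq0 => [/allP h|i _]; last exact: sqr_ge0.
  apply/eqP/matrixP => i j; rewrite ord1 mxE.
  by have := h j (mem_index_enum j); rewrite sqrf_eq0 => /eqP.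
have formD : `|(v *m D *m v^T) 0 0| <= (4 * d)^-1 * c * N%:R * n2.
  rewrite mxE (le_trans (ler_norm_sum _ _ _)) //.
  apply: (@le_trans _ _ (\sum_(j < N) \sum_(i < N)
      (4 * d)^-1 * c * ((v 0 i ^+ 2 + v 0 j ^+ 2) / 2))).
    apply: ler_sum => j _; rewrite !mxE mulr_suml.
    rewrite (le_trans (ler_norm_sum _ _ _)) // ler_sum // => i _.
    rewrite mulrAC normrM mulrC ler_pM //.
    rewrite normrM -(real_normK (num_real (v 0 i))).
    rewrite -(real_normK (num_real (v 0 j))).
    have := sqr_ge0 (`|v 0 i| - `|v 0 j|); nra.
  set k := (4 * d)^-1 * c.
  have sumE : \sum_(j < N) \sum_(i < N) (v 0 i ^+ 2 + v 0 j ^+ 2) =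
      2 * N%:R * n2.
    under eq_bigr do rewrite big_split /= sumr_const card_ord.
    by rewrite big_split /= sumr_const card_ord sumrMnl -/n2 -mulrA !mulr_natl.
  suff -> : \sum_(j < N) \sum_(i < N) k * ((v 0 i ^+ 2 + v 0 j ^+ 2) / 2) =
      k / 2 * (2 * N%:R * n2).
    by rewrite le_eqVlt; apply/orP; left; apply/eqP; field.
  rewrite -sumE mulr_sumr; apply: eq_bigr => j _.
  by rewrite mulr_sumr; apply: eq_bigr => i _; field.
have -> : v *m (- (B *m X + X *m B^T)) *m v^T =
    v *m v^T - (v *m D *m v^T + (v *m D *m v^T)^T).
  have -> : - (B *m X + X *m B^T) = 1%:M - (D + D^T).
    have [Xsym _] := psdX.
    rewrite /D trmx_mul Xsym linearB /= mulmxBl mulmxBr addrACA -opprD lyapX.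
    by rewrite opprK; rewrite [in RHS]opprD addrCA subrr addr0.
  rewrite mulmxBr mulmxBl mulmx1 mulmxDr mulmxDl; congr (_ - (_ + _)).
  by rewrite !trmx_mul trmxK mulmxA.
move: (v *m D *m v^T) formD => Y formD.
have -> : (v *m v^T - (Y + Y^T)) 0 0 = (v *m v^T) 0 0 - (Y 0 0 + Y 0 0).
  by rewrite mxE; congr (_ + _); rewrite !mxE.
have -> : (v *m v^T) 0 0 = n2.
  by rewrite mxE; apply: eq_bigr => i _; rewrite mxE expr2.
have small : (4 * d)^-1 * c * N%:R * n2 <= n2 / 4.
  rewrite [leRHS]mulrC ler_wpM2r ?(ltW n2_gt0) // -mulrA mulrC.
  rewrite ler_pdivrMr ?mulr_gt0 // mulrA mulVf // mul1r /d.
  by rewrite lerDr.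
move: formD; rewrite ler_norml => /andP[_ h]; lra.
Qed.

End LyapunovSolution.

Section Observability.
Variables (R : realType) (N k : nat).

Lemma observable_ker j (C : 'M[R]_(k, N)) (A : 'M[R]_N) (D : 'M[R]_(N, j)) :
  observable C A -> (forall i, C *m A ^+ i *m D = 0) -> D = 0.
Proof.
rewrite /observable => rkO CAD.
set O := (\mxcol_i _) in rkO.
have /row_fullP[L LO] : row_full O by rewrite /row_full rkO.
rewrite -[D]mul1mx -LO -mulmxA /O mxcol_mul.
under eq_mxcol do rewrite CAD.
by rewrite mxcol0 mulmx0.
Qed.

(** If C D = 0, sandwiching the equation between C and C^T gives C S = 0;
    multiplying it by C alone then leaves C A D = 0, and the argument repeats
    with C A in place of C. *)
Lemma lyapunov_unobservable (C : 'M[R]_(k, N)) (A D S : 'M[R]_N) :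
  D^T = D -> A *m D + D *m A^T = - (S *m S^T) -> C *m D = 0 ->
  forall i, C *m A ^+ i *m D = 0.
Proof.
move=> Dsym lyapD CD0 i; elim: i C CD0 => [|i IHi] C CD0.
  by rewrite expr0 mulmx1.
rewrite exprS; change (A * A ^+ i) with (A *m A ^+ i); rewrite mulmxA.
apply: IHi.
have DC0 : D *m C^T = 0 by rewrite -Dsym -trmx_mul CD0 trmx0.
have CS0 : C *m S = 0.
  apply: mxtrace_mul_tr_eq0; rewrite trmx_mul mulmxA -(mulmxA C).
  rewrite -[S *m S^T]opprK -lyapD mulmxN mulNmx mulmxDr mulmxDl.
  by rewrite !mulmxA CD0 !mul0mx -mulmxA DC0 mulmx0 addr0 oppr0 mxtrace0.
have /(congr1 (mulmx C)) := lyapD.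
by rewrite mulmxDr !mulmxA CD0 mul0mx addr0 mulmxN mulmxA CS0 mul0mx oppr0.
Qed.

End Observability.

(** * The closed loop and its augmentation *)

Lemma h2norm_eq (R : realType) k l (T T' : R[i] -> 'M[R[i]]_(k, l)) :
  (forall w : R, T (0 +i* w)%C = T' (0 +i* w)%C) -> h2norm T = h2norm T'.
Proof.
move=> TT'; rewrite /h2norm; congr (Num.sqrt (_ * _)).
by congr Rintegral; apply/funext => w; rewrite TT'.
Qed.

Section ClosedLoop.
Variables (R : realType) (n m p : nat) (G : plant R n m p).

Lemma lqg_cost_lyapunov q (K : policy R m p q) (X : 'M[R]_(n + q)) :
  stabilizing G K ->
  Acl G K *m X + X *m (Acl G K)^T = - (Bcl G K *m (Bcl G K)^T) ->
  lqg_cost G K = Num.sqrt (\tr (Ccl G K *m X *m (Ccl G K)^T)).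
Proof. by move=> hK lyapX; exact: (h2norm_lyapunov hK). Qed.

Hypothesis hG : standing_assumptions G.

(** A trajectory with zero output has zero control, as R^(1/2) is invertible, so
    its plant part follows the uncontrolled plant with zero output and vanishes
    by observability of (Q^(1/2), A). *)
Lemma closed_loop_unobservable q (K : policy R m p q) j
    (D : 'M[R]_(n + q, j)) :
  (forall i, Ccl G K *m Acl G K ^+ i *m D = 0) -> usubmx D = 0.
Proof.
move=> CAD; pose x i := usubmx (Acl G K ^+ i *m D).
pose y i := dsubmx (Acl G K ^+ i *m D).
(* x and y are the plant and controller parts of the state after i steps. *)
have out i : sqrtmx (plQ G) *m x i = 0 /\ poC K *m y i = 0.
  have := CAD i; rewrite -mulmxA -[_ *m D]vsubmxK -/(x i) -/(y i).
  rewrite mul_block_col !mul0mx addr0 add0r -col_mx0.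
  move=> /eq_col_mx[-> Ry]; split=> //.
  rewrite -mulmxA in Ry.
  rewrite -[RHS](mulmx0 _ (invmx (sqrtmx (plR G)))) -Ry mulKmx //.
  exact: sqrtmx_unit (plR_pd hG).
have xS i : x i.+1 = plA G *m x i.
  rewrite {1}/x exprS -[_ * _]/(_ *m _) -mulmxA -[_ *m D]vsubmxK.
  rewrite -/(x i) -/(y i).
  rewrite /Acl mul_block_col col_mxKu -mulmxA.
  by have [_ ->] := out i; rewrite mulmx0 addr0.
have xE i : x i = plA G ^+ i *m x 0%N.
  elim: i => [|i IHi]; first by rewrite expr0 mul1mx.
  by rewrite xS IHi mulmxA exprS.
have <- : x 0%N = usubmx D by rewrite /x expr0 mul1mx.
apply: (observable_ker (plQA_observable hG)) => i.
by rewrite -mulmxA -xE; have [] := out i.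
Qed.

(** Zero gain would make the plant rows of the Gramian vanish; the plant block
    of the Lyapunov equation then reads W = 0, against controllability of
    (A, W^(1/2)). *)
Lemma closed_loop_gain_gt0 q (K : policy R m p q) (X : 'M[R]_(n + q)) :
  (0 < n)%N -> stabilizing G K ->
  Acl G K *m X + X *m (Acl G K)^T = - (Bcl G K *m (Bcl G K)^T) ->
  0 < \tr (Ccl G K *m X *m (Ccl G K)^T).
Proof.
move=> n_gt0 hK lyapX.
have psdX : psdmx X.
  by apply: (lyapunov_psd hK _ lyapX); exact: psdmx_gram.
rewrite lt_def (lyapunov_trace_ge0 hK _ lyapX) andbT; apply/eqP => tr0.
have CX0 := psdmx_trace_eq0 psdX tr0.
have X1 : usubmx X = 0.
  apply: (closed_loop_unobservable (K := K)).
  have [S SS] := psdmx_factor (psdmx_gram (Bcl G K)); rewrite SS in lyapX.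
  by apply: (lyapunov_unobservable _ lyapX) => //; case: psdX.
have XT1 : lsubmx X = 0.
  by have [<- _] := psdX; rewrite -trmx_usub X1 trmx0.
have W0 : sqrtmx (plW G) = 0.
  apply: mxtrace_mul_tr_eq0; apply/eqP; rewrite -oppr_eq0 -raddfN; apply/eqP.
  have := congr1 (fun Y => ulsubmx Y) lyapX.
  rewrite /Bcl tr_block_mx mulmx_block !trmx0 !mulmx0 !addr0 opp_block_mx.
  rewrite block_mxKul => <-.
  rewrite /ulsubmx !linearD /= -!mul_usub_mx X1 mul0mx -mulmx_lsub XT1.
  by rewrite mulmx0 linear0 addr0 mxtrace0.
have := plAW_controllable hG; rewrite /controllable W0.
under eq_mxrow do rewrite mulmx0.
by rewrite mxrow0 mxrank0 => n0; rewrite -n0 in n_gt0.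
Qed.

End ClosedLoop.

Section Augmentation.
Variables (R : realType) (n m p : nat) (G : plant R n m p).
Variables (q q' : nat) (K : policy R m p q) (L : 'M[R]_q').

(** With [aug_rest], the coordinates of the augmented closed loop: the original
    closed-loop state and the added controller state.  The nested blocks
    absorb the reassociation of n + (q + q'). *)
Definition aug_emb : 'M[R]_(n + q, n + (q + q')) :=
  block_mx 1%:M 0 0 (row_mx 1%:M 0).
Definition aug_rest : 'M[R]_(q', n + (q + q')) := row_mx 0 (row_mx 0 1%:M).

Let E := aug_emb.
Let F := aug_rest.
Let K' := augment_policy K L.

Local Ltac expand_blocks :=
  rewrite ?(tr_block_mx, tr_row_mx, tr_col_mx, trmx0, trmx1);
  rewrite ?(mulmx_block, mul_block_col, mul_row_block, mul_row_col,
            mul_col_row, mul_mx_row, mul_col_mx, mulmx1, mul1mx, mulmx0,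
            mul0mx, addr0, add0r).

Lemma aug_embK : E *m E^T = 1%:M.
Proof.
by rewrite /E /aug_emb; expand_blocks; rewrite -scalar_mx_block.
Qed.

Lemma aug_emb_rest : E *m F^T = 0.
Proof.
by rewrite /E /F /aug_emb /aug_rest; expand_blocks; rewrite col_mx0.
Qed.

Lemma aug_partition : E^T *m E + F^T *m F = 1%:M.
Proof.
rewrite /E /F /aug_emb /aug_rest; expand_blocks.
by rewrite row_mx0 !add_block_mx !addr0 !add0r -!scalar_mx_block.
Qed.

Lemma Acl_augment : E *m Acl G K' = Acl G K *m E.
Proof.
rewrite /E /F /aug_emb /aug_rest /Acl /Ccl /Bcl /K' /augment_policy.
rewrite /poA /poB /poC /=.
by expand_blocks.
Qed.

Lemma Acl_augmentT : Acl G K' *m E^T = E^T *m Acl G K.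
Proof.
rewrite /E /F /aug_emb /aug_rest /Acl /Ccl /Bcl /K' /augment_policy.
rewrite /poA /poB /poC /=.
by expand_blocks; rewrite !col_mx0 addr0 add0r.
Qed.

Lemma Acl_augment_rest : Acl G K' *m F^T = F^T *m L.
Proof.
rewrite /E /F /aug_emb /aug_rest /Acl /Ccl /Bcl /K' /augment_policy.
rewrite /poA /poB /poC /=.
by expand_blocks.
Qed.

Lemma Ccl_augment : Ccl G K' = Ccl G K *m E.
Proof.
rewrite /E /F /aug_emb /aug_rest /Acl /Ccl /Bcl /K' /augment_policy.
rewrite /poA /poB /poC /=.
by expand_blocks; rewrite row_mx0.
Qed.

Lemma Bcl_augment : Bcl G K' = E^T *m Bcl G K.
Proof.
rewrite /E /F /aug_emb /aug_rest /Acl /Ccl /Bcl /K' /augment_policy.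
rewrite /poA /poB /poC /=.
by expand_blocks; rewrite col_mx0.
Qed.

Hypotheses (hK : stabilizing G K) (hL : stable_mx L).

(** A left eigenvector of the augmented loop projects to left eigenvectors of
    the two diagonal blocks, and not both projections vanish. *)
Lemma augment_stabilizing : stabilizing G K'.
Proof.
move=> z /eigenvalueP[v vA v0].
have [wE0|wE0] := eqVneq (v *m cplxmx E^T) 0; last first.
  apply: hK; apply/eigenvalueP; exists (v *m cplxmx E^T) => //.
  by rewrite -mulmxA -cplxmxM -Acl_augmentT cplxmxM mulmxA vA scalemxAl.
have [wF0|wF0] := eqVneq (v *m cplxmx F^T) 0; last first.
  apply: hL; apply/eigenvalueP; exists (v *m cplxmx F^T) => //.
  by rewrite -mulmxA -cplxmxM -Acl_augment_rest cplxmxM mulmxA vA scalemxAl.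
case/eqP: v0; rewrite -[v]mulmx1.
have <- : cplxmx (1%:M : 'M[R]_(n + (q + q'))) = 1%:M.
  by rewrite /cplxmx map_mx1.
rewrite -aug_partition /cplxmx map_mxD -!/(cplxmx _) !cplxmxM mulmxDr !mulmxA.
by rewrite wE0 wF0 !mul0mx addr0.
Qed.

Lemma augment_transfer (w : R) :
  transfer G K' (0 +i* w)%C = transfer G K (0 +i* w)%C.
Proof.
have E1 : cplxmx E *m cplxmx E^T = 1%:M.
  by rewrite -cplxmxM aug_embK /cplxmx map_mx1.
have RE : cplxmx E *m resolvent (Acl G K') w =
    resolvent (Acl G K) w *m cplxmx E.
  rewrite -[LHS]mul1mx -(resolvent_mulmx hK w) -mulmxA; congr (_ *m _).
  rewrite mulmxA mulmxBl -cplxmxM -Acl_augment cplxmxM.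
  rewrite mul_scalar_mx -mul_mx_scalar.
  by rewrite -mulmxBr -mulmxA (mulmx_resolvent augment_stabilizing) mulmx1.
rewrite /transfer -!/(resolvent _ _) Ccl_augment Bcl_augment !cplxmxM.
rewrite -[_ *m cplxmx E *m _]mulmxA RE !mulmxA.
by rewrite -[_ *m cplxmx E *m _]mulmxA E1 mulmx1.
Qed.

Lemma augment_lqg_cost : lqg_cost G K' = lqg_cost G K.
Proof.
by apply: h2norm_eq => w; exact: augment_transfer.
Qed.

Lemma augment_lyapunov (X : 'M[R]_(n + q)) :
  Acl G K *m X + X *m (Acl G K)^T = - (Bcl G K *m (Bcl G K)^T) ->
  Acl G K' *m (E^T *m X *m E) + (E^T *m X *m E) *m (Acl G K')^T =
  - (Bcl G K' *m (Bcl G K')^T).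
Proof.
move=> lyapX.
have ET : E *m (Acl G K')^T = (Acl G K)^T *m E.
  by apply: trmx_inj; rewrite !trmx_mul !trmxK Acl_augmentT.
transitivity (E^T *m (Acl G K *m X + X *m (Acl G K)^T) *m E).
  rewrite -(mulmxA _ E) ET mulmxDr mulmxDl !mulmxA.
  by rewrite Acl_augmentT.
by rewrite lyapX Bcl_augment trmx_mul trmxK mulmxN mulNmx !mulmxA.
Qed.

End Augmentation.

(** * Degeneracy of augmented policies *)

Section Degeneracy.
Variables (R : realType) (n m p : nat) (G : plant R n m p).
Hypotheses (hG : standing_assumptions G) (n_gt0 : (0 < n)%N).

Lemma cast_policy_id q (K : policy R m p q) (e : q = q) : cast_policy e K = K.
Proof.
case: K => -[KA KB] KC.
by rewrite /cast_policy /poA /poB /poC /= !castmx_id.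
Qed.

Lemma lqg_cost_gt0 q (K : policy R m p q) : stabilizing G K -> 0 < lqg_cost G K.
Proof.
move=> hK; have lyapX := lyapunov_solP (- (Bcl G K *m (Bcl G K)^T)) hK.
rewrite (lqg_cost_lyapunov hK lyapX) sqrtr_gt0.
exact: closed_loop_gain_gt0.
Qed.

(** The matrix inequalities of [nondegenerate_policy], for any controller order
    and level; the order must vary because the augmented policy has order
    q + q' and reaches order n only through a cast. *)
Definition lqg_certificate q (K : policy R m p q) (gam : R)
    (P : 'M[R]_(n + q)) (Gam : 'M[R]_(n + m)) : Prop :=
  [/\ pdmx P,
      nsdmx (block_mx ((Acl G K)^T *m P + P *m Acl G K) (P *m Bcl G K)
                      ((Bcl G K)^T *m P) (- gam%:M)),
      psdmx (block_mx P (Ccl G K)^T (Ccl G K) Gam) &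
      \tr Gam <= gam].

(** Congruence of the first inequality by (Y, B^T / gam) eliminates its second
    block, as in a Schur complement; the factor gam clears denominators. *)
Lemma certificate_lyapunov q (K : policy R m p q) gam P Gam : 0 < gam ->
  lqg_certificate K gam P Gam ->
  psdmx (- (Acl G K *m (gam *: invmx P) + (gam *: invmx P) *m (Acl G K)^T +
            Bcl G K *m (Bcl G K)^T)).
Proof.
move=> gam_gt0 [Ppd nsd1 _ _]; have P_unit := pdmx_unit Ppd.
have [Psym _] := Ppd.
have Ysym : (invmx P)^T = invmx P by rewrite trmx_inv Psym.
set A := Acl G K in nsd1 *; set B := Bcl G K in nsd1 *.
set Y := invmx P in Ysym *.
have YP : Y *m P = 1%:M by exact: mulVmx.
have PY : P *m Y = 1%:M by exact: mulmxV.
pose S := col_mx Y (gam^-1 *: B^T).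
have := psdmx_scale (ltW gam_gt0) (psdmx_congr S nsd1); congr psdmx.
rewrite mulmxN mulNmx scalerN; congr (- _).
rewrite tr_col_mx linearZ /= trmxK Ysym mul_row_block mul_row_col.
have -> : Y *m (P *m B) + gam^-1 *: B *m - gam%:M = 0.
  rewrite mulmxA YP mul1mx mulmxN mul_mx_scalar scalerA mulfV ?gt_eqF //.
  by rewrite scale1r subrr.
rewrite mul0mx addr0 mulmxDr !mulmxDl !mulmxA YP mul1mx -!mulmxA PY !mulmx1.
rewrite -scalemxAl scalerDr scalerDr scalerA mulfV ?gt_eqF // scale1r.
by rewrite -scalemxAr -scalemxAl [X in X + _]addrC.
Qed.

(** Congruence of the second inequality by (- Y C^T, 1) produces the Schur
    complement Gam - C Y C^T. *)
Lemma certificate_trace q (K : policy R m p q) gam P Gam :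
  lqg_certificate K gam P Gam ->
  \tr (Ccl G K *m invmx P *m (Ccl G K)^T) <= gam.
Proof.
move=> [Ppd _ psd2 trG]; have P_unit := pdmx_unit Ppd.
have [Psym _] := Ppd.
have Ysym : (invmx P)^T = invmx P by rewrite trmx_inv Psym.
apply: le_trans trG; rewrite -subr_ge0 -raddfB.
set C := Ccl G K in psd2 *; set Y := invmx P in Ysym *.
have YP : Y *m P = 1%:M by exact: mulVmx.
have := psdmx_trace_ge0 (psdmx_congr (col_mx (- (Y *m C^T)) 1%:M) psd2).
rewrite tr_col_mx trmx1 linearN /= trmx_mul trmxK Ysym.
rewrite mul_row_block mul_row_col.
rewrite !mul1mx !mulmx1 !mulNmx -(mulmxA C Y P) YP mulmx1 addNr mul0mx add0r.
by rewrite addrC.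
Qed.

(** The trace bounds force C D = 0 for D = gam Y - X, with X the Gramian of the
    augmented loop, so the plant rows of D vanish; X vanishes on the added
    states, hence the plant rows of Y do too. *)
Lemma augment_certificate q q' (K : policy R m p q) (L : 'M[R]_q') P Gam :
  stabilizing G K -> stable_mx L -> (0 < q')%N ->
  let K' := augment_policy K L in lqg_certificate K' (lqg_cost G K') P Gam ->
  exists2 v : 'cV[R]_(q + q'), v != 0 & usubmx (invmx P *m col_mx 0 v) = 0.
Proof.
move=> hK hL q'_gt0 K'.
have hK' : stabilizing G K' by exact: augment_stabilizing.
set gam := lqg_cost G K' => cert.
have gam_gt0 : 0 < gam by exact: lqg_cost_gt0.
have lyapX := lyapunov_solP (- (Bcl G K *m (Bcl G K)^T)) hK.
move: (lyapunov_sol _ _) lyapX => X lyapX.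
have lyapX' := augment_lyapunov L lyapX; set E := aug_emb R n q q' in lyapX'.
have gam2 : \tr (Ccl G K' *m (E^T *m X *m E) *m (Ccl G K')^T) = gam ^+ 2.
  rewrite /gam (lqg_cost_lyapunov hK' lyapX') sqr_sqrtr //.
  by apply/ltW; exact: closed_loop_gain_gt0 lyapX'.
have psdM := certificate_lyapunov gam_gt0 cert.
have trY := certificate_trace cert.
pose D := gam *: invmx P - E^T *m X *m E.
have lyapD : Acl G K' *m D + D *m (Acl G K')^T =
    - - (Acl G K' *m (gam *: invmx P) + (gam *: invmx P) *m (Acl G K')^T +
            Bcl G K' *m (Bcl G K')^T).
  by rewrite opprK /D mulmxBr mulmxBl addrACA -opprD lyapX' opprK.
have psdD := lyapunov_psd hK' psdM lyapD.
have CD0 : Ccl G K' *m D = 0.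
  apply: (psdmx_trace_eq0 psdD); apply/eqP; rewrite eq_le; apply/andP; split.
    rewrite /D mulmxBr mulmxBl raddfB /= gam2 -scalemxAr -scalemxAl mxtraceZ.
    by rewrite subr_le0 expr2 ler_wpM2l // ltW.
  by rewrite -{1}[Ccl G K']trmxK; apply/psdmx_trace_ge0/psdmx_congr.
have [S SS] := psdmx_factor psdM; rewrite SS in lyapD.
have D1 : usubmx D = 0.
  apply: (closed_loop_unobservable hG (K := K')).
  by apply: (lyapunov_unobservable _ lyapD) => //; case: psdD.
(* Any nonzero vector supported on the added controller states will do. *)
exists (col_mx 0 (const_mx 1)).
  apply/eqP => /matrixP /(_ (rshift q (Ordinal q'_gt0)) 0).
  by rewrite col_mxEd !mxE => /eqP; rewrite oner_eq0.
set w := col_mx 0 _.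
have Ew : E *m w = 0.
  have -> : w = (aug_rest R n q q')^T *m const_mx 1.
    rewrite /w /aug_rest !tr_row_mx !trmx0 trmx1.
    by rewrite !mul_col_mx !mul0mx mul1mx.
  by rewrite mulmxA aug_emb_rest mul0mx.
have Yw : invmx P *m w = gam^-1 *: (D *m w).
  by rewrite /D mulmxBl -!mulmxA Ew !mulmx0 subr0 -scalemxAl scalerK // gt_eqF.
by rewrite Yw linearZ /= -mul_usub_mx D1 mul0mx scaler0.
Qed.

Lemma augment_degenerate q (K : policy R m p q) q' (e : (q + q' = n)%N)
    (L : 'M[R]_q') : stabilizing G K -> stable_mx L -> (0 < q')%N ->
  (stabilizing G (q := n) `\` nondegenerate_policy G)
    (cast_policy e (augment_policy K L)).
Proof.
move=> hK hL q'_gt0.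
(* Freeing the order r from n lets the cast be eliminated. *)
suff cast_free r (e' : (q + q' = r)%N) :
    let K' := cast_policy e' (augment_policy K L) in
    stabilizing G K' /\ forall P Gam,
    lqg_certificate K' (lqg_cost G K') P Gam ->
    exists2 v : 'cV[R]_r, v != 0 & usubmx (invmx P *m col_mx 0 v) = 0.
  have [hK' noP] := cast_free n e; split=> // -[_ [P [Gam]]] /=.
  move=> [[Ppd P12] _ nsd1 psd2 trG].
  have [v v0 Yv] := noP P Gam (And4 Ppd nsd1 psd2 trG).
  have P_unit := pdmx_unit Ppd.
  (* z = Y (0, v) has the form (0, z2), and the plant rows of P z = (0, v) say
     that P12 z2 = 0. *)
  case/eqP: v0; move: Yv; set z := invmx P *m _ => z1.
  have Pz : P *m z = col_mx 0 v by rewrite /z mulmxA mulmxV // mul1mx.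
  have zE : z = col_mx 0 (dsubmx z) by rewrite -z1 vsubmxK.
  have := congr1 usubmx Pz; rewrite col_mxKu zE -{1}[P]submxK mul_block_col.
  rewrite mulmx0 add0r col_mxKu => /(congr1 (mulmx (invmx (ursubmx P)))).
  rewrite mulKmx // mulmx0 => z2.
  have : col_mx 0 v = 0 :> 'cV[R]_(n + n) by rewrite -Pz zE z2 col_mx0 mulmx0.
  by move=> /(congr1 dsubmx); rewrite col_mxKd linear0.
case: r / e'; rewrite cast_policy_id /=.
split; first exact: augment_stabilizing.
by move=> P Gam; exact: augment_certificate.
Qed.

End Degeneracy.

(** * Differentiability of the cost *)

Lemma near_eq_differentiable (R : realType) (V : normedModType R)
    (f g : V -> R) (x : V) :
  (\near x, f x = g x) -> differentiable g x -> differentiable f x.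
Proof.
move=> fg dg; have fgx : f x = g x by exact: nbhs_singleton fg.
have fE : f \o shift x = cst (f x) + 'd g x +o_ 0 id.
  apply/eqaddoP => e e_gt0.
  have /eqaddoP/(_ e e_gt0) := diff_locally dg.
  have : \forall h \near (0 : V), f (h + x) = g (h + x).
    by rewrite (near_shift x) /= sub0r; near=> y; rewrite /= subrK; near: y.
  apply: filter_app2; near=> h.
  by rewrite fgx !fctE /= => ->.
have c : continuous ('d g x) by apply: diff_continuous.
by apply/diff_locallyP; rewrite (diff_unique c fE).
Unshelve. all: by end_near. Qed.

Section EntrywiseDifferentiable.
Variables (R : realType) (V : normedModType R) (x : V).

Lemma differentiable_bigsum (I : Type) (r : seq I) (P : pred I)
    (f : I -> V -> R) :
  (forall i, differentiable (f i) x) ->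
  differentiable (fun y => \sum_(i <- r | P i) f i y) x.
Proof.
move=> df; elim: r => [|i r IHr].
  by under eq_fun do rewrite big_nil; exact: differentiable_cst.
under eq_fun do rewrite big_cons; case: (P i) => //.
exact: differentiableD.
Qed.

Lemma differentiable_bigprod (I : Type) (r : seq I) (P : pred I)
    (f : I -> V -> R) :
  (forall i, differentiable (f i) x) ->
  differentiable (fun y => \prod_(i <- r | P i) f i y) x.
Proof.
move=> df; elim: r => [|i r IHr].
  by under eq_fun do rewrite big_nil; exact: differentiable_cst.
under eq_fun do rewrite big_cons; case: (P i) => //.
exact: differentiableM.
Qed.

(** Entrywise, so that closure under the matrix operations that define the cost
    reduces to the rules for real-valued functions. *)
Definition mxdiff k l (f : V -> 'M[R]_(k, l)) : Prop :=
  forall i j, differentiable (fun y => f y i j) x.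

Lemma mxdiff_cst k l (M : 'M[R]_(k, l)) : mxdiff (fun=> M).
Proof. by move=> i j; exact: differentiable_cst. Qed.

Lemma mxdiffD k l (f g : V -> 'M[R]_(k, l)) : mxdiff f -> mxdiff g ->
  mxdiff (fun y => f y + g y).
Proof.
move=> df dg i j; under eq_fun do rewrite mxE; exact: differentiableD.
Qed.

Lemma mxdiffN k l (f : V -> 'M[R]_(k, l)) : mxdiff f -> mxdiff (fun y => - f y).
Proof.
by move=> df i j; under eq_fun do rewrite mxE; exact: differentiableN.
Qed.

Lemma mxdiffM k l j (f : V -> 'M[R]_(k, l)) (g : V -> 'M[R]_(l, j)) :
  mxdiff f -> mxdiff g -> mxdiff (fun y => f y *m g y).
Proof.
move=> df dg a b; under eq_fun do rewrite mxE.
by apply: differentiable_bigsum => i; exact: differentiableM.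
Qed.

Lemma mxdiff_tr k l (f : V -> 'M[R]_(k, l)) : mxdiff f ->
  mxdiff (fun y => (f y)^T).
Proof. by move=> df i j; under eq_fun do rewrite mxE; exact: df. Qed.

Lemma mxdiff_scale k l (c : V -> R) (f : V -> 'M[R]_(k, l)) :
  differentiable c x -> mxdiff f -> mxdiff (fun y => c y *: f y).
Proof.
by move=> dc df i j; under eq_fun do rewrite mxE; exact: differentiableM.
Qed.

Lemma mxdiff_block k1 k2 l1 l2 (f11 : V -> 'M[R]_(k1, l1)) f12 f21
    (f22 : V -> 'M[R]_(k2, l2)) :
  mxdiff f11 -> mxdiff f12 -> mxdiff f21 -> mxdiff f22 ->
  mxdiff (fun y => block_mx (f11 y) (f12 y) (f21 y) (f22 y)).
Proof.
move=> d11 d12 d21 d22 i j.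
case: (split_ordP i) => i' ->; case: (split_ordP j) => j' ->.
- by under eq_fun do rewrite block_mxEul; exact: d11.
- by under eq_fun do rewrite block_mxEur; exact: d12.
- by under eq_fun do rewrite block_mxEdl; exact: d21.
- by under eq_fun do rewrite block_mxEdr; exact: d22.
Qed.

Lemma differentiable_mxtrace k (f : V -> 'M[R]_k) : mxdiff f ->
  differentiable (fun y => \tr (f y)) x.
Proof. by move=> df; apply: differentiable_bigsum. Qed.

Lemma differentiable_det k (f : V -> 'M[R]_k) : mxdiff f ->
  differentiable (fun y => \det (f y)) x.
Proof.
move=> df; apply: differentiable_bigsum => s; apply: differentiableM.
  exact: differentiable_cst.
by apply: differentiable_bigprod.
Qed.

Lemma mxdiff_adj k (f : V -> 'M[R]_k) : mxdiff f ->
  mxdiff (fun y => \adj (f y)).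
Proof.
move=> df i j; under eq_fun do rewrite mxE; apply: differentiableM.
  exact: differentiable_cst.
apply: differentiable_det => a b; under eq_fun do rewrite !mxE; exact: df.
Qed.

Lemma mxdiff_mxvec k l (f : V -> 'M[R]_(k, l)) : mxdiff f ->
  mxdiff (fun y => mxvec (f y)).
Proof.
move=> df i j; rewrite ord1; case/mxvec_indexP: j => a b.
by under eq_fun do rewrite mxvecE; exact: df.
Qed.

Lemma mxdiff_vec_mx k l (f : V -> 'rV[R]_(k * l)) : mxdiff f ->
  mxdiff (fun y => vec_mx (f y)).
Proof. by move=> df i j; under eq_fun do rewrite mxE; exact: df. Qed.

Lemma mxdiff_lin_mx k l k' l' (f : V -> 'M[R]_(k, l) -> 'M[R]_(k', l')) :
  (forall M, mxdiff (fun y => f y M)) -> mxdiff (fun y => lin_mx (f y)).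
Proof.
move=> df i j; under eq_fun do rewrite !mxE /=.
exact: (mxdiff_mxvec (df _)).
Qed.

Lemma mxdiff_lyapunov_sol k (A M : V -> 'M[R]_k) : mxdiff A -> mxdiff M ->
  stable_mx (A x) -> mxdiff (fun y => lyapunov_sol (A y) (M y)).
Proof.
move=> dA dM A_stable.
have dL : mxdiff (fun y => lyapunov_mx (A y)).
  apply: mxdiffD; apply: mxdiff_lin_mx => N.
    by apply: mxdiffM => //; exact: mxdiff_cst.
  by apply: mxdiffM; [exact: mxdiff_cst|exact: mxdiff_tr].
apply: mxdiff_vec_mx; apply: mxdiffM; first exact: mxdiff_mxvec.
apply: mxdiff_scale; last exact: mxdiff_adj.
apply: differentiableV; first exact: differentiable_det.
by have := lyapunov_mx_unit A_stable; rewrite unitmxE unitfE.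
Qed.

Lemma near_stable k (A : V -> 'M[R]_k) : mxdiff A -> stable_mx (A x) ->
  \forall y \near x, stable_mx (A y).
Proof.
move=> dA /stable_mx_open[e e_gt0 eP].
suff : \forall y \near x, forall i j, `|A y i j - A x i j| < e.
  by apply: filterS => y; exact: eP.
apply: filter_forall => i; apply: filter_forall => j.
have /differentiable_continuous := dA i j.
by move=> /cvgrPdist_lt /(_ e e_gt0); apply: filterS => y; rewrite distrC.
Qed.

End EntrywiseDifferentiable.

Section CostDifferentiable.
Variables (R : realType) (n m p : nat) (G : plant R n m p) (q : nat).
Implicit Types K : policy R m p q.

Lemma differentiable_fst (U W : normedModType R) (z : U * W) :
  differentiable (fst : U * W -> U) z.
Proof. by apply: linear_differentiable => t; exact: cvg_fst. Qed.

Lemma differentiable_snd (U W : normedModType R) (z : U * W) :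
  differentiable (snd : U * W -> W) z.
Proof. by apply: linear_differentiable => t; exact: cvg_snd. Qed.

Lemma mxdiff_poA K : mxdiff K (fun K' : policy R m p q => poA K').
Proof.
move=> i j.
apply: (@differentiable_comp _ _ _ _ (fun K' : policy R m p q => K'.1.1)
  (fun M : 'M[R]_q => M i j)); last exact: differentiable_coord.
exact: (differentiable_comp (differentiable_fst _) (differentiable_fst _)).
Qed.

Lemma mxdiff_poB K : mxdiff K (fun K' : policy R m p q => poB K').
Proof.
move=> i j.
apply: (@differentiable_comp _ _ _ _ (fun K' : policy R m p q => K'.1.2)
  (fun M : 'M[R]_(q, p) => M i j)); last exact: differentiable_coord.
exact: (differentiable_comp (differentiable_fst _) (differentiable_snd _)).
Qed.

Lemma mxdiff_poC K : mxdiff K (fun K' : policy R m p q => poC K').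
Proof.
move=> i j.
apply: (@differentiable_comp _ _ _ _ (fun K' : policy R m p q => K'.2)
  (fun M : 'M[R]_(m, q) => M i j)); last exact: differentiable_coord.
exact: differentiable_snd.
Qed.

Lemma mxdiff_Acl K : mxdiff K (fun K' : policy R m p q => Acl G K').
Proof.
apply: mxdiff_block; first exact: mxdiff_cst.
- by apply: mxdiffM; [exact: mxdiff_cst|exact: mxdiff_poC].
- by apply: mxdiffM; [exact: mxdiff_poB|exact: mxdiff_cst].
- exact: mxdiff_poA.
Qed.

Lemma mxdiff_Bcl K : mxdiff K (fun K' : policy R m p q => Bcl G K').
Proof.
apply: mxdiff_block; do ?exact: mxdiff_cst.
by apply: mxdiffM; [exact: mxdiff_poB|exact: mxdiff_cst].
Qed.

Lemma mxdiff_Ccl K : mxdiff K (fun K' : policy R m p q => Ccl G K').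
Proof.
apply: mxdiff_block; do ?exact: mxdiff_cst.
by apply: mxdiffM; [exact: mxdiff_cst|exact: mxdiff_poC].
Qed.

Lemma near_stabilizing K : stabilizing G K ->
  \forall K' \near K, stabilizing G K'.
Proof. by move=> hK; apply: near_stable hK; exact: mxdiff_Acl. Qed.

(** Near K the cost is the square root of a positive rational function of the
    entries of the policy. *)
Lemma lqg_cost_differentiable K :
  standing_assumptions G -> (0 < n)%N -> stabilizing G K ->
  differentiable (lqg_cost G (q := q)) K.
Proof.
move=> hG n_gt0 hK.
pose X (K' : policy R m p q) :=
  lyapunov_sol (Acl G K') (- (Bcl G K' *m (Bcl G K')^T)).
pose phi (K' : policy R m p q) : R := \tr (Ccl G K' *m X K' *m (Ccl G K')^T).
have lyapX K' : stabilizing G K' ->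
    Acl G K' *m X K' + X K' *m (Acl G K')^T = - (Bcl G K' *m (Bcl G K')^T).
  exact: lyapunov_solP.
apply: (@near_eq_differentiable _ _ _ (Num.sqrt \o phi)).
  apply: filterS (near_stabilizing hK) => K' hK'.
  exact: lqg_cost_lyapunov (lyapX _ hK').
apply: differentiable_comp.
  apply: differentiable_mxtrace.
  apply: mxdiffM; last exact/mxdiff_tr/mxdiff_Ccl.
  apply: mxdiffM; first exact: mxdiff_Ccl.
  apply: mxdiff_lyapunov_sol => //; first exact: mxdiff_Acl.
  by apply: mxdiffN; apply: mxdiffM; [|apply: mxdiff_tr]; exact: mxdiff_Bcl.
apply/derivable1_diffP.
have phi_gt0 : 0 < phi K by exact: closed_loop_gain_gt0 (lyapX _ hK).
by have [] := is_derive1_sqrt phi_gt0.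
Qed.

End CostDifferentiable.

(** * Stationarity of augmented policies *)

Section Stationarity.
Variables (R : realType) (n m p : nat) (G : plant R n m p).

Lemma derive_line (V W : normedModType R) (f : V -> W) (a v : V) :
  'D_v f a = 'D_1 (fun h : R => f (h *: v + a)) 0.
Proof.
rewrite /derive; set F := (X in X @ _); set F' := (X in _ = lim (X @ _)).
suff -> : F = F' by [].
apply/funext => h; rewrite /F /F' /=.
by rewrite scale0r add0r addr0 -[h *: 1]/(h * 1) mulr1.
Qed.

(** The partial derivatives are the values of the differential on a basis. *)
Lemma gradient_eq0 q (f : policy R m p q -> R) (K : policy R m p q) :
  differentiable f K ->
  gradient f K = 0 <-> forall D, 'D_D f K = 0.
Proof.
move=> df; split=> [[gA gB gC]|D0]; last first.
  by congr (_, _, _); apply/matrixP => i j; rewrite !mxE D0.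
move=> [[DA DB] DC]; rewrite deriveE //.
have lin0 k l (inj : 'M[R]_(k, l) -> policy R m p q) (M : 'M[R]_(k, l)) :
    (forall c M N, inj (c *: M + N) = c *: inj M + inj N) ->
    (forall i j, 'D_(inj (delta_mx i j)) f K = 0) -> 'd f K (inj M) = 0.
  move=> inj_lin inj0; have inj00 : inj 0 = 0.
    by have := inj_lin (-1) 0 0; rewrite !scaleN1r oppr0 addr0 addNr.
  rewrite [M]matrix_sum_delta.
  elim/big_ind: _ => [|M1 M2 h1 h2|i _].
  - by rewrite inj00 linear0.
  - by rewrite -[M1]scale1r inj_lin scale1r linearD h1 h2 addr0.
  elim/big_ind: _ => [|M1 M2 h1 h2|j _].
  - by rewrite inj00 linear0.
  - by rewrite -[M1]scale1r inj_lin scale1r linearD h1 h2 addr0.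
  rewrite -[_ *: _]addr0 inj_lin inj00 addr0 linearZ /= -deriveE //.
  by rewrite inj0 scaler0.
have -> : (DA, DB, DC) =
    ((DA, 0, 0) : policy R m p q) + ((0, DB, 0) + (0, 0, DC)).
  by congr (_, _, _); rewrite /= ?addr0 ?add0r.
rewrite !linearD /=.
rewrite (lin0 _ _ (fun M => (M, 0, 0)) DA); first last.
- by move=> i j; have /matrixP/(_ i j) := gA; rewrite !mxE.
- by move=> c M N; congr (_, _, _); rewrite /= scaler0 addr0.
rewrite (lin0 _ _ (fun M => (0, M, 0)) DB); first last.
- by move=> i j; have /matrixP/(_ i j) := gB; rewrite !mxE.
- by move=> c M N; congr (_, _, _); rewrite /= scaler0 addr0.
rewrite (lin0 _ _ (fun M => (0, 0, M)) DC); first last.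
- by move=> i j; have /matrixP/(_ i j) := gC; rewrite !mxE.
- by move=> c M N; congr (_, _, _); rewrite /= scaler0 addr0.
by rewrite !addr0.
Qed.

(** Change of controller coordinates by an involution S, so that S is its own
    inverse. *)
Definition conj_policy q (S : 'M[R]_q) (K : policy R m p q) : policy R m p q :=
  (S *m poA K *m S, S *m poB K, poC K *m S).

(** A singular M is covered too: [invmx] is the identity on singular matrices,
    and conjugation preserves singularity. *)
Lemma invmx_involutive_conj k (T M : 'M[R[i]]_k) : T *m T = 1%:M ->
  invmx (T *m M *m T) = T *m invmx M *m T.
Proof.
move=> TT; have T_unit : T \in unitmx by have [] := mulmx1_unit TT.
have [M_unit|M_nunit] := boolP (M \in unitmx); last first.
  by rewrite !invmx_out // inE !unitmx_mul (negbTE M_nunit) andbF.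
have N_unit : T *m M *m T \in unitmx by rewrite !unitmx_mul T_unit M_unit.
rewrite -[LHS]mulmx1; apply: (canLR (mulKmx N_unit)).
rewrite !mulmxA -(mulmxA _ T T) TT mulmx1 -(mulmxA _ M) mulmxV // mulmx1.
by rewrite TT.
Qed.

Lemma conj_lqg_cost q (S : 'M[R]_q) (K : policy R m p q) : S *m S = 1%:M ->
  lqg_cost G (conj_policy S K) = lqg_cost G K.
Proof.
move=> SS; pose T : 'M[R]_(n + q) := block_mx 1%:M 0 0 S.
have TT : T *m T = 1%:M.
  rewrite /T mulmx_block !mul1mx !mulmx0 !mul0mx !addr0 add0r SS.
  by rewrite -scalar_mx_block.
have AT : Acl G (conj_policy S K) = T *m Acl G K *m T.
  rewrite /T /Acl !mulmx_block !mul1mx !mul0mx !mulmx0 !mulmx1 !addr0 !add0r.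
  by rewrite /poA /poB /poC /= !mulmxA.
have BT : Bcl G (conj_policy S K) = T *m Bcl G K.
  rewrite /T /Bcl !mulmx_block !mul1mx !mul0mx !mulmx0 !addr0 !add0r.
  by rewrite /poB /= !mulmxA.
have CT : Ccl G (conj_policy S K) = Ccl G K *m T.
  rewrite /T /Ccl !mulmx_block !mul0mx !mulmx0 !mulmx1 !addr0 !add0r.
  by rewrite /poC /= !mulmxA.
have cTT : cplxmx T *m cplxmx T = 1%:M by rewrite -cplxmxM TT /cplxmx map_mx1.
apply: h2norm_eq => w; rewrite /transfer AT BT CT !cplxmxM.
set s := (0 +i* w)%C; set M := s%:M - cplxmx (Acl G K).
have -> : s%:M - cplxmx T *m cplxmx (Acl G K) *m cplxmx T =
    cplxmx T *m M *m cplxmx T.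
  rewrite /M mulmxBr mulmxBl mul_mx_scalar -scalemxAl cTT.
  by rewrite scalemx1.
rewrite invmx_involutive_conj // !mulmxA.
rewrite -(mulmxA _ (cplxmx T) (cplxmx T)) cTT mulmx1.
by rewrite -(mulmxA _ (cplxmx T) (cplxmx T)) cTT mulmx1.
Qed.

Variables (hG : standing_assumptions G) (n_gt0 : (0 < n)%N).
Variables (q q' : nat) (K : policy R m p q) (L : 'M[R]_q').
Hypotheses (hK : stabilizing G K) (hL : stable_mx L).
Let K' := augment_policy K L.
Let hK' : stabilizing G K' := augment_stabilizing hK hL.
Let dK' : differentiable (lqg_cost G (q := q + q')) K' :=
  lqg_cost_differentiable hG n_gt0 hK'.

(** Block-diagonal perturbations of the augmented policy are augmentations of
    perturbed policies, which stay stabilizing for small steps. *)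
Lemma derive_augment (DK : policy R m p q) (DL : 'M[R]_q') :
  'D_(augment_policy DK DL) (lqg_cost G (q := q + q')) K' =
  'D_DK (lqg_cost G (q := q)) K.
Proof.
rewrite derive_line [RHS]derive_line; apply: near_eq_derive.
pose N : 'M[R]_(n + q) :=
  block_mx 0 (plB G *m poC DK) (poB DK *m plC G) (poA DK).
have AclE (h : R) : Acl G (h *: DK + K) = h *: N + Acl G K.
  rewrite /N /Acl scale_block_mx add_block_mx scaler0 add0r.
  by rewrite scalemxAr scalemxAl -mulmxDr -mulmxDl.
have near_line k (M D : 'M[R]_k) : stable_mx M ->
    \forall h \near (0 : R), stable_mx (h *: D + M).
  move=> hM; apply: near_stable; last by rewrite scale0r add0r.
  apply: mxdiffD; last exact: mxdiff_cst.
  by apply: mxdiff_scale => //; exact: mxdiff_cst.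
apply: filterS2 (near_line _ _ N hK) (near_line _ _ DL hL) => h sN sL.
have sK : stabilizing G (h *: DK + K).
  by rewrite -AclE in sN; exact: sN.
rewrite -(augment_lqg_cost sK sL); congr lqg_cost.
rewrite /K' /augment_policy /poA /poB /poC /=.
congr (_, _, _) => /=.
- by rewrite scale_block_mx add_block_mx !scaler0 !addr0.
- by rewrite scale_col_mx add_col_mx scaler0 addr0.
- by rewrite scale_row_mx add_row_mx scaler0 addr0.
Qed.

Definition offdiag_policy (A12 : 'M[R]_(q, q')) (A21 : 'M[R]_(q', q))
    (B2 : 'M[R]_(q', p)) (C2 : 'M[R]_(m, q')) : policy R m p (q + q') :=
  (block_mx 0 A12 A21 0, col_mx 0 B2, row_mx 0 C2).

(** The coordinate change diag(1, -1) preserves the cost, fixes the augmented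
    policy and reverses these directions, so the cost is even along them. *)
Lemma derive_offdiag A12 A21 B2 C2 :
  'D_(offdiag_policy A12 A21 B2 C2) (lqg_cost G (q := q + q')) K' = 0.
Proof.
set D := offdiag_policy _ _ _ _; pose f := lqg_cost G (q := q + q').
pose S : 'M[R]_(q + q') := block_mx 1%:M 0 0 (- 1%:M).
have SS : S *m S = 1%:M.
  rewrite /S mulmx_block !mul1mx !mulmx0 !mul0mx !addr0 add0r mulNmx mulmxN.
  by rewrite mul1mx opprK -scalar_mx_block.
have DN : 'D_(- D) f K' = - 'D_D f K'.
  by rewrite (deriveE _ dK') (deriveE _ dK') linearN.
(* By evenness the derivatives along D and - D agree, so both vanish. *)
suff : 'D_(- D) f K' = 'D_D f K'.
  rewrite DN; move: ('D_D f K') => x /eqP.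
  by rewrite eq_sym -addr_eq0 -mulr2n mulrn_eq0 => /eqP.
rewrite [LHS]derive_line [RHS]derive_line.
apply: (congr1 (fun g : R -> R => 'D_1 g 0)); apply/funext => h.
rewrite /f -[RHS](conj_lqg_cost _ SS); congr (lqg_cost G _).
rewrite /K' /D /augment_policy /offdiag_policy /conj_policy.
rewrite /poA /poB /poC /= /S.
congr (_, _, _) => /=.
- rewrite !(scale_block_mx, opp_block_mx, add_block_mx) !mulmx_block.
  by rewrite !(mul1mx, mulmx1, mul0mx, mulmx0, mulNmx, mulmxN, scaler0, addr0,
               add0r, oppr0, opprK, scalerN).
- rewrite opp_col_mx !scale_col_mx !add_col_mx mul_block_col.
  by rewrite !(mul1mx, mul0mx, mulNmx, scaler0, addr0, add0r, oppr0, opprK,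
               scalerN).
- rewrite opp_row_mx !scale_row_mx !add_row_mx mul_row_block.
  by rewrite !(mulmx1, mulmx0, mulmxN, scaler0, addr0, add0r, oppr0, opprK,
               scalerN).
Qed.

Lemma augment_stationary : stationary_point G K -> stationary_point G K'.
Proof.
move=> [_ dK gradK]; split=> //; apply/(gradient_eq0 dK') => -[[DA DB] DC].
pose D1 : policy R m p q := (ulsubmx DA, usubmx DB, lsubmx DC).
have -> : (DA, DB, DC) = augment_policy D1 (drsubmx DA) +
    offdiag_policy (ursubmx DA) (dlsubmx DA) (dsubmx DB) (rsubmx DC).
  rewrite /augment_policy /offdiag_policy /poA /poB /poC /=.
  congr (_, _, _) => /=.
  - by rewrite add_block_mx !addr0 !add0r submxK.
  - by rewrite add_col_mx addr0 add0r vsubmxK.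
  - by rewrite add_row_mx addr0 add0r hsubmxK.
rewrite deriveE // linearD /= -!deriveE // derive_augment derive_offdiag addr0.
exact: (gradient_eq0 dK).1.
Qed.

End Stationarity.

Theorem theorem4p4 (R : realType) (n m p : nat) (G : plant R n m p)
    (n_gt0 : (0 < n)%N) (m_gt0 : (0 < m)%N) (p_gt0 : (0 < p)%N)
    (hG : standing_assumptions G)
    (q : nat) (q_lt_n : (q < n)%N)
    (K : policy R m p q) (hK : stabilizing G K) :
  [/\ forall (q' : nat) (L : 'M[R]_q'), (0 < q')%N -> stable_mx L ->
        stabilizing G (augment_policy K L) /\
        lqg_cost G (augment_policy K L) = lqg_cost G K,
      stationary_point G K ->
      forall (q' : nat) (L : 'M[R]_q'), (0 < q')%N -> stable_mx L ->
        stationary_point G (augment_policy K L) &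
      minimal_policy K ->
      forall L : 'M[R]_(n - q), stable_mx L ->
        (stabilizing G (q := n) `\` nondegenerate_policy G)
          (cast_policy (subnKC (ltnW q_lt_n)) (augment_policy K L))].
Proof.
split=> [q' L _ hL|statK q' L _ hL|_ L hL].
- by split; [exact: augment_stabilizing|exact: augment_lqg_cost].
- exact: augment_stationary.
- by apply: augment_degenerate; rewrite ?subn_gt0.
Qed.
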